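(* Let $N\ge 3$ and consider the following two random quantum circuit ensembles on $N$ qubits (local dimension $2$). The ensemble $C$ is the random unitary $U_5U_4U_3U_2U_1$, where the $U_i$ are independent and each $U_i$ is a Haar-random unitary on its support (tensored with the identity elsewhere), with supports: $U_1$ acts on qubits $\{2,3,\dots,N\}$, $U_2$ acts on qubits $\{1,2\}$, $U_3$ acts on qubits $\{1,3,4,\dots,N\}$, $U_4$ acts on qubits $\{1,2\}$, and $U_5$ acts on qubits $\{2,3,\dots,N\}$. The ensemble $C'$ is obtained by deleting $U_2$ and $U_4$, i.e. it is the random unitary $U_5U_3U_1$ with the same supports for $U_1,U_3,U_5$. For a positive integer $d$, $C^d$ (resp. $C'^d$) denotes the product of $d$ independent copies of a unitary drawn from $C$ (resp. $C'$). Then for all sufficiently large $N$ there exist $\epsilon>0$ and a positive integer $d$ such that $C'^d$ is an $\epsilon$-approximate $2$-design but $C^d$ is not. This holds both when ''$\epsilon$-approximate $2$-design'' is understood in the additive-error sense and when it is understood in the multiplicative-error sense.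
   Context: For a probability distribution $\nu$ on unitaries acting on $\mathcal{H}=(\mathbb{C}^2)^{\otimes N}$, its $t$-th moment operator is the channel $\Phi_\nu(X)=\mathbb{E}_{U\sim\nu}\left[U^{\otimes t}X(U^\dagger)^{\otimes t}\right]$ on operators on $\mathcal{H}^{\otimes t}$; $\Phi_{\mathrm{Haar}}$ denotes the moment operator of the Haar measure on the full unitary group of $\mathcal{H}$. The ensemble $\nu$ is an $\epsilon$-approximate $t$-design with additive error if $\|\Phi_\nu-\Phi_{\mathrm{Haar}}\|_\diamond\le\epsilon$ (diamond norm). It is an $\epsilon$-approximate $t$-design with multiplicative error if both $\epsilon\Phi_{\mathrm{Haar}}+(\Phi_\nu-\Phi_{\mathrm{Haar}})$ and $\epsilon\Phi_{\mathrm{Haar}}-(\Phi_\nu-\Phi_{\mathrm{Haar}})$ are completely positive. Here $t=2$. *)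

(* Defs.v *)
From HB Require Import structures.
From mathcomp Require Import all_boot all_order all_algebra.
From mathcomp Require Import complex.
From mathcomp Require Import all_classical all_reals all_analysis.

Set Implicit Arguments.
Unset Strict Implicit.
Unset Printing Implicit Defensive.

Import Order.TTheory GRing.Theory Num.Theory.
Local Open Scope classical_set_scope.
Local Open Scope ring_scope.

Section Operators.
Variables (R : realType) (T : finType).

Definition op := T -> T -> R[i].

Definition opmul (A B : op) : op := fun x y => \sum_z A x z * B z y.
Definition adj (A : op) : op := fun x y => conjc (A y x).
Definition idop : op := fun x y => (x == y)%:R.
Definition is_unitary (U : op) : Prop :=
  forall x y, opmul (adj U) U x y = idop x y /\ opmul U (adj U) x y = idop x y.

Definition psd (P : op) : Prop :=
  forall v : T -> R[i], 0 <= \sum_x \sum_y conjc (v x) * P x y * v y.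

(* ||A||_1 = r, i.e. r = tr sqrt(A^dagger A), sqrt = the PSD square root *)
Definition is_trace_norm (A : op) (r : R) : Prop :=
  exists P : op, psd P /\ (forall x y, opmul P P x y = opmul (adj A) A x y)
                 /\ \sum_x P x x = Complex r 0.

Definition chan := op -> op.
Definition chan_add (F G : chan) : chan := fun X x y => F X x y + G X x y.
Definition chan_sub (F G : chan) : chan := fun X x y => F X x y - G X x y.
Definition chan_scale (c : R) (F : chan) : chan := fun X x y => Complex c 0 * F X x y.

End Operators.

Definition tens_id (R : realType) (A B : finType) (Phi : chan R A) : chan R (A * B)%type :=
  fun Y x y => Phi (fun a a' => Y (a, x.2) (a', y.2)) x.1 y.1.

Definition is_cp (R : realType) (A : finType) (Phi : chan R A) : Prop :=
  forall (k : nat) (Y : op R (A * 'I_k)%type), psd Y -> psd (@tens_id _ _ 'I_k Phi Y).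

(* ||Phi||_diamond <= eps, with ||Phi||_diamond = sup_{||X||_1 <= 1} ||(Phi (x) id_A)(X)||_1 *)
Definition diamond_le (R : realType) (A : finType) (Phi : chan R A) (eps : R) : Prop :=
  forall (X : op R (A * A)%type) (r : R), is_trace_norm X r -> r <= 1 ->
  forall s : R, is_trace_norm (@tens_id _ _ A Phi X) s -> s <= eps.

(* N qubits: computational basis labels {ffun 'I_N -> bool}; qubit j (1-based) *)
(* of the paper is index j-1 : 'I_N.                                          *)
Definition qb (N : nat) := {ffun 'I_N -> bool}.

Definition Mt (R : realType) (N : nat) := op R (qb N).
HB.instance Definition _ R N := Choice.on (Mt R N).
HB.instance Definition _ R N := isPointed.Build (Mt R N) (fun _ _ => 0).

(* Borel sigma-algebra on operators: generated by real and imaginary parts of entries *)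
Definition entry_sets (R : realType) (N : nat) : set (set (Mt R N)) :=
  fun S => exists (x y : qb N) (A : set R), measurable A /\
     (S = [set U | A (complex.Re (U x y))] \/ S = [set U | A (complex.Im (U x y))]).

Definition MT (R : realType) (N : nat) := g_sigma_algebraType (@entry_sets R N).

Section Qubits.
Variables (R : realType) (N : nat).

(* U = V (x) Id on the qubits outside S *)
Definition acts_within (S : {set 'I_N}) (U : Mt R N) : Prop :=
  exists V : Mt R N,
    (forall x y x' y' : qb N, [forall i in S, x i == x' i] -> [forall i in S, y i == y' i] ->
        V x y = V x' y') /\
    (forall x y : qb N, U x y = ([forall i in ~: S, x i == y i])%:R * V x y).

Definition local_unitaries (S : {set 'I_N}) : set (MT R N) :=
  [set U | is_unitary U /\ acts_within S U].

Definition is_haar (S : {set 'I_N}) (mu : probability (MT R N) R) : Prop :=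
  mu (local_unitaries S) = 1%E /\
  forall V : Mt R N, local_unitaries S V ->
  forall A : set (MT R N), measurable A ->
    mu [set U | A (opmul V U)] = mu A /\ mu [set U | A (opmul U V)] = mu A.

Definition cexp (mu : probability (MT R N) R) (f : MT R N -> R[i]) : R[i] :=
  Complex (Rintegral mu setT (fun U => complex.Re (f U)))
          (Rintegral mu setT (fun U => complex.Im (f U))).

Definition tens2 (U : Mt R N) : op R (qb N * qb N)%type := fun x y => U x.1 y.1 * U x.2 y.2.

Definition moment2 (mu : probability (MT R N) R) : chan R (qb N * qb N)%type :=
  fun X a b => cexp mu (fun U => opmul (opmul (tens2 U) X) (adj (tens2 U)) a b).

Definition additive_design (Phi PhiHaar : chan R (qb N * qb N)%type) (eps : R) : Prop :=
  diamond_le (chan_sub Phi PhiHaar) eps.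

Definition multiplicative_design (Phi PhiHaar : chan R (qb N * qb N)%type) (eps : R) : Prop :=
  is_cp (chan_add (chan_scale eps PhiHaar) (chan_sub Phi PhiHaar)) /\
  is_cp (chan_sub (chan_scale eps PhiHaar) (chan_sub Phi PhiHaar)).

(* supports (paper's 1-based qubit j = index j-1) *)
Definition S_23N : {set 'I_N} := [set i : 'I_N | (1 <= i)%N].        (* {2,...,N} *)
Definition S_12 : {set 'I_N} := [set i : 'I_N | (i < 2)%N].          (* {1,2} *)
Definition S_134N : {set 'I_N} := [set i : 'I_N | (i : nat) != 1%N].  (* {1,3,...,N} *)

(* moment operator of U5 U4 U3 U2 U1 with independent U_i:
   E[...] = Phi_5 o Phi_4 o Phi_3 o Phi_2 o Phi_1 (iterated expectation) *)
Definition moment_C (mu1 mu2 mu3 : probability (MT R N) R) : chan R (qb N * qb N)%type :=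
  moment2 mu1 \o moment2 mu2 \o moment2 mu3 \o moment2 mu2 \o moment2 mu1.

Definition moment_C' (mu1 mu3 : probability (MT R N) R) : chan R (qb N * qb N)%type :=
  moment2 mu1 \o moment2 mu3 \o moment2 mu1.

End Qubits.

(* Main.v *)
Require Import Defs.
From HB Require Import structures.
From mathcomp Require Import all_boot all_order all_algebra.
From mathcomp Require Import complex.
From mathcomp Require Import all_classical all_reals all_analysis.
From mathcomp Require Import measurable_realfun ring lra.
Set Implicit Arguments.
Unset Strict Implicit.
Unset Printing Implicit Defensive.
Import Order.TTheory GRing.Theory Num.Theory.
Local Open Scope classical_set_scope.
Local Open Scope ring_scope.

(**
The second moment of a Haar unitary on a set S of qubits is the projection, orthogonal for
<X, Z> = tr (X Z), onto the commutant of the V (x) V with V local on S; this commutant is spanned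
by the identity and the swap of S, with coefficients acting off S.  Writing F_T for the swap of
the qubits in T, the projection maps F_T to a combination of F_(T minus S) and F_(T union S) with
explicit weights.  Both circuits therefore have second moment
  Phi_Haar + la (E - Phi_Haar),
where E projects onto the span of the identity, F_1, F_(2..N) and F_(1..N), and only la depends on
the circuit.  With eta = 2^-(N-2), a = (3/4) eta / (1 - eta^2/4) and
b = (1/2) (1 - eta^2) / (1 - eta^2/4), one finds la' = a^2 for C' and la = (2b/5)^2 for C, so that
0 < la' < la as soon as N >= 5.  In the joint eigenprojectors of F_1 and F_(2..N) the maps above are
block channels, completely positive iff their kernel is nonnegative.  Taking eps = la^d / 2 and d
large separates the two circuits for both notions of design: (la' / la)^d tends to 0, whereas
E - Phi_Haar fixes an operator of trace norm 1, and eps Phi_Haar + la^d (E - Phi_Haar) has a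
negative kernel entry.
*)

(** * Operators and completely positive maps *)

(** The gap between the circuits is the cost of moving a swap. In C' a large gate meeting F_1 either
    erases it, leaving an operator that every gate fixes, or spreads it over N - 2 further qubits at
    cost about eta. In C the gate on {1,2} first spreads it by one qubit at cost 2/5, and the large
    gate then erases it from one of these two at cost about 1/2; so a is exponentially small while
    2b/5 tends to 1/5. All this is read modulo the identity and F_(1..N), which every twirl fixes.
    In each step of either circuit one of the two terms of the twirl lies in that span, so a single
    coefficient is tracked; F_1 and F_(2..N) return with the same one, and the discarded components
    are recovered at the end from the symmetry of the channel and its two fixed points. The weights
    need no integration formula: a twirl is pinned down by its range and by its pairings with the
    commutant, and the commutant is computed from matrix units. Nor is the diamond norm of the
    difference computed: at every depth the difference from Phi_Haar is a scalar times one fixed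
    channel, so any finite bound on that channel suffices. *)

Lemma sum_pair (V : nmodType) (A B : finType) (f : A * B -> V) :
  \sum_p f p = \sum_a \sum_b f (a, b).
Proof. by rewrite pair_bigA; apply: eq_bigr => -[]. Qed.

Lemma conjcD (R : realType) (a b : R[i]) : conjc (a + b) = conjc a + conjc b.
Proof. exact: rmorphD. Qed.

Lemma conjcM (R : realType) (a b : R[i]) : conjc (a * b) = conjc a * conjc b.
Proof. exact: rmorphM. Qed.

Section OperatorAlgebra.
Variables (R : realType) (T : finType).
Implicit Types A B D X Y Z : op R T.

Definition optr A : R[i] := \sum_x A x x.

(** Bilinear rather than Hermitian, so scalars leave either argument unconjugated; definiteness is
    recovered by pairing with the adjoint, as in [pairing_adj_eq0]. *)
Definition pairing A B : R[i] := \sum_x \sum_y A x y * B y x.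

Lemma opmulA A B D : opmul A (opmul B D) = opmul (opmul A B) D.
Proof.
apply/funext => x; apply/funext => y; rewrite /opmul.
under eq_bigr => z _ do rewrite mulr_sumr.
rewrite exchange_big; apply: eq_bigr => z _; rewrite mulr_suml.
by apply: eq_bigr => w _; rewrite mulrA.
Qed.

Lemma sum_delta (x : T) (f : T -> R[i]) : \sum_z (x == z)%:R * f z = f x.
Proof.
rewrite (bigD1 x) //= eqxx mul1r big1 ?addr0 // => z zx.
by rewrite eq_sym (negbTE zx) mul0r.
Qed.

Lemma sum_delta_r (x : T) (f : T -> R[i]) : \sum_z f z * (z == x)%:R = f x.
Proof.
rewrite -[RHS](sum_delta x f); apply: eq_bigr => z _.
by rewrite mulrC eq_sym.
Qed.

Lemma opmul1l A : opmul (@idop R T) A = A.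
Proof. by apply/funext => x; apply/funext => y; rewrite /opmul sum_delta. Qed.

Lemma opmul1r A : opmul A (@idop R T) = A.
Proof. by apply/funext => x; apply/funext => y; rewrite /opmul sum_delta_r. Qed.

Lemma adj_opmul A B : adj (opmul A B) = opmul (adj B) (adj A).
Proof.
apply/funext => x; apply/funext => y; rewrite /adj /opmul rmorph_sum.
by apply: eq_bigr => z _; rewrite rmorphM mulrC.
Qed.

Lemma adjK A : adj (adj A) = A.
Proof. by apply/funext => x; apply/funext => y; rewrite /adj conjcK. Qed.

Lemma pairingE A B : pairing A B = optr (opmul A B).
Proof. by []. Qed.

Lemma pairingC A B : pairing A B = pairing B A.
Proof.
rewrite /pairing exchange_big; apply: eq_bigr => x _; apply: eq_bigr => y _.
by rewrite mulrC.
Qed.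

Lemma pairing_opmul A B D : pairing (opmul A B) D = pairing B (opmul D A).
Proof. by rewrite [LHS]pairingE -opmulA -pairingE pairingC pairingE -opmulA. Qed.

Lemma pairingDl A B D :
  pairing (fun x y => A x y + B x y) D = pairing A D + pairing B D.
Proof.
rewrite /pairing -big_split; apply: eq_bigr => x _.
by rewrite -big_split; apply: eq_bigr => y _; rewrite mulrDl.
Qed.

Lemma pairingZl c A D : pairing (fun x y => c * A x y) D = c * pairing A D.
Proof.
rewrite /pairing mulr_sumr; apply: eq_bigr => x _.
by rewrite mulr_sumr; apply: eq_bigr => y _; rewrite mulrA.
Qed.

Lemma pairingZr c A D : pairing D (fun x y => c * A x y) = c * pairing D A.
Proof. by rewrite !(pairingC D) pairingZl. Qed.

Lemma pairing_suml (I : finType) (A : I -> op R T) D :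
  pairing (fun x y => \sum_i A i x y) D = \sum_i pairing (A i) D.
Proof.
rewrite /pairing [RHS]exchange_big; apply: eq_bigr => x _.
rewrite [RHS]exchange_big; apply: eq_bigr => y _.
by rewrite mulr_suml.
Qed.

Lemma pairing_sumr (I : finType) (A : I -> op R T) D :
  pairing D (fun x y => \sum_i A i x y) = \sum_i pairing D (A i).
Proof. by rewrite pairingC pairing_suml; apply: eq_bigr => i _; rewrite pairingC. Qed.

Lemma pairing_adj_eq0 A : pairing A (adj A) = 0 -> A = fun _ _ => 0.
Proof.
move=> /eqP; rewrite /pairing psumr_eq0 => [/allP h|x _]; last first.
  by apply: sumr_ge0 => y _; rewrite mulcJ_ge0.
apply/funext => x; apply/funext => y.
have /= := h x (mem_index_enum x); rewrite psumr_eq0 => [/allP /(_ y (mem_index_enum y)) /=|z _].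
  by rewrite /adj mulf_eq0 conjc_eq0 orbb => /eqP.
by rewrite mulcJ_ge0.
Qed.

End OperatorAlgebra.

Section CompletelyPositive.
Variables (R : realType) (A : finType).

(** This is the Kraus map of the rank-one operator |u><w|. Contracting the test vector with [u]
    leaves a vector [z] on the ancilla, and the quadratic form of the image is that of [Y] at w (x)
    z. *)
Lemma cp_rank1 (u w : A -> R[i]) :
  is_cp (fun (X : op R A) x y =>
    u x * conjc (u y) * \sum_a \sum_b conjc (w a) * X a b * w b).
Proof.
move=> k Y Ypsd v.
pose z (j : 'I_k) := \sum_x conjc (u x) * v (x, j).
have := Ypsd (fun p => w p.1 * z p.2); congr (0 <= _).
rewrite !sum_pair exchange_big [RHS]exchange_big; apply: eq_bigr => j _ /=.
under eq_bigr => a _ do rewrite sum_pair exchange_big /=.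
under [in RHS]eq_bigr => x _ do rewrite sum_pair exchange_big /=.
rewrite exchange_big [RHS]exchange_big; apply: eq_bigr => l _ /=.
rewrite /tens_id /=.
set S := \sum_a \sum_b conjc (w a) * Y (a, j) (b, l) * w b.
transitivity (conjc (z j) * z l * S).
  rewrite /S mulr_sumr; apply: eq_bigr => a _; rewrite mulr_sumr; apply: eq_bigr => b _.
  by rewrite rmorphM; ring.
rewrite /z rmorph_sum !mulr_suml; apply: eq_bigr => x _.
rewrite -mulrA mulr_suml mulr_sumr; apply: eq_bigr => y _.
by rewrite rmorphM /= conjcK; ring.
Qed.

Lemma cp_scale (c : R) (F : chan R A) : 0 <= c -> is_cp F -> is_cp (chan_scale c F).
Proof.
move=> c0 Fcp k Y Yp v; have := mulr_ge0 (_ : 0 <= c%:C%C) (Fcp k Y Yp v).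
rewrite ler0c => /(_ c0); congr (0 <= _); rewrite mulr_sumr; apply: eq_bigr => x _.
by rewrite mulr_sumr; apply: eq_bigr => y _; rewrite /tens_id /chan_scale complexr0; ring.
Qed.

Lemma cp_sum (I : finType) (F : I -> chan R A) :
  (forall i, is_cp (F i)) -> is_cp (fun X x y => \sum_i F i X x y).
Proof.
move=> Fcp k Y Yp v.
have : 0 <= \sum_i \sum_x \sum_y conjc (v x) * tens_id (F i) Y x y * v y.
  by apply: sumr_ge0 => i _; apply: Fcp.
congr (0 <= _); rewrite exchange_big; apply: eq_bigr => x _.
rewrite exchange_big; apply: eq_bigr => y _.
by rewrite /tens_id mulr_sumr mulr_suml.
Qed.

End CompletelyPositive.

(** * Positive semidefinite operators and the trace norm *)

(** Turns a bound on a square into one on the number itself without a square root; it is lossy, but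
    the estimates built on it only have to be finite. *)
Lemma le_1Dsqr (K : numFieldType) (z : K) : 0 <= z -> z <= 1 + z ^+ 2.
Proof.
move=> z0; have h : 0 <= (1 - z) ^+ 2.
  by apply: real_exprn_even_ge0; rewrite ?rpredB // ger0_real.
have : 0 <= 2^-1 * ((1 - z) ^+ 2 + z ^+ 2 + 1).
  by rewrite mulr_ge0 ?invr_ge0 // !addr_ge0 // exprn_ge0.
by rewrite -[z <= _]subr_ge0; congr (0 <= _); field.
Qed.

Section PositiveSemidefinite.
Variables (R : realType) (T : finType).
Implicit Types P A : op R T.

Lemma psd_two_points P (x y : T) (a b : R[i]) : psd P ->
  0 <= conjc a * P x x * a + conjc a * P x y * b
     + (conjc b * P y x * a + conjc b * P y y * b).
Proof.
move=> Pp; have := Pp (fun u => (x == u)%:R * a + (y == u)%:R * b).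
congr (0 <= _).
have inner u : \sum_w conjc ((x == u)%:R * a + (y == u)%:R * b) * P u w *
   ((x == w)%:R * a + (y == w)%:R * b) =
   (x == u)%:R * (conjc a * P u x * a + conjc a * P u y * b) +
   (y == u)%:R * (conjc b * P u x * a + conjc b * P u y * b).
  set v := conjc _.
  under eq_bigr => w _ do rewrite mulrDr mulrCA [X in _ + X]mulrCA.
  rewrite big_split /= !sum_delta /v rmorphD /= !rmorphM /= !conjc_nat; ring.
under eq_bigr => u _ do rewrite inner.
by rewrite big_split /= !sum_delta.
Qed.

Lemma psd_diag_ge0 P x : psd P -> 0 <= P x x.
Proof.
move=> /(psd_two_points x x 1 0).
by rewrite conjc0 conjc1 !mulr0 !mul0r !mulr1 !mul1r !addr0.
Qed.

(** Polarization: the quadratic form is real at e_x + e_y and at e_x + i e_y, which matches the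
    imaginary and then the real parts of the two entries. *)
Lemma psd_conj P x y : psd P -> conjc (P x y) = P y x.
Proof.
move=> Pp; have := psd_two_points x y 1 1 Pp; have := psd_two_points x y 1 'i%C Pp.
move: (psd_diag_ge0 x Pp) (psd_diag_ge0 y Pp).
case: (P x x) (P x y) (P y x) (P y y) => [a1 a2] [b1 b2] [c1 c2] [d1 d2].
rewrite !lecE /= => /andP[/eqP e1 _] /andP[/eqP e2 _] /andP[/eqP e3 _] /andP[/eqP e4 _].
by apply/eqP; rewrite eq_complex /=; apply/andP; split; apply/eqP; lra.
Qed.

(** Diagonal entries are at most 1, so testing on e_x + e_y, e_x - e_y, e_x + i e_y and e_x - i e_y
    bounds the real and the imaginary part of the entry by 1 in absolute value; hence the constant
    2. *)
Lemma psd_entry_bound P x y : psd P -> optr P <= 1 -> P x y * P y x <= 2.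
Proof.
move=> Pp Ptr.
have d1 z : P z z <= 1.
  apply: le_trans Ptr; rewrite /optr (bigD1 z) //= lerDl; apply: sumr_ge0 => w _.
  exact: psd_diag_ge0.
have := psd_two_points x y 1 1 Pp; have := psd_two_points x y 1 'i%C Pp.
have := psd_two_points x y 1 (-1) Pp; have := psd_two_points x y 1 (- 'i%C) Pp.
move: (psd_diag_ge0 x Pp) (psd_diag_ge0 y Pp) (d1 x) (d1 y) (psd_conj x y Pp).
case: (P x x) (P x y) (P y x) (P y y) => [a1 a2] [b1 b2] [c1 c2] [e1 e2].
rewrite !lecE /= => /andP[/eqP ? ?] /andP[/eqP ? ?] /andP[/eqP ? ?] /andP[/eqP ? ?].
move=> [? ?] /andP[/eqP ? ?] /andP[/eqP ? ?] /andP[/eqP ? ?] /andP[/eqP ? ?].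
apply/andP; split; first by apply/eqP; subst; ring.
have ? : b1 ^+ 2 <= 1 by subst; nra.
have ? : b2 ^+ 2 <= 1 by subst; nra.
by subst; nra.
Qed.

Lemma psd_sqrt_diag (Q A : op R T) x : psd Q ->
  (forall y z, opmul Q Q y z = opmul (adj A) A y z) ->
  \sum_z Q x z * Q z x = \sum_z `|A z x| ^+ 2.
Proof.
move=> Qp /(_ x x); rewrite /opmul => ->; apply: eq_bigr => z _.
by rewrite sqr_normc mulrC.
Qed.

(** The squared entry is at most the diagonal entry at [y] of [adj A] times [A], which is also that
    of the square of the root [Q], a sum of products bounded by [psd_entry_bound]. *)
Lemma trace_norm_entry_bound A (r : R) x y : is_trace_norm A r -> r <= 1 ->
  `|A x y| <= 1 + \sum_(z : T) 2.
Proof.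
move=> [Q [Qp [QA Qtr]]] r1.
have Q1 : optr Q <= 1 by rewrite /optr Qtr complexr0 -(rmorph1 (real_complex R)) lecR.
have h : `|A x y| ^+ 2 <= \sum_(z : T) 2.
  apply: (@le_trans _ _ (\sum_z `|A z y| ^+ 2)).
    by rewrite (bigD1 x) //= lerDl; apply: sumr_ge0 => z _; rewrite exprn_ge0.
  rewrite -(psd_sqrt_diag y Qp QA); apply: ler_sum => z _; exact: psd_entry_bound.
apply: le_trans (_ : 1 + `|A x y| ^+ 2 <= _); last by rewrite lerD2l.
exact: le_1Dsqr.
Qed.

Lemma trace_norm_bound A (s : R) (M : R[i]) : is_trace_norm A s ->
  (forall x y, `|A x y| <= M) -> s%:C%C <= \sum_(x : T) (1 + \sum_(z : T) M ^+ 2).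
Proof.
move=> [Q [Qp [QA Qtr]]] AM; rewrite -complexr0 -Qtr; apply: ler_sum => x _.
have q0 := psd_diag_ge0 x Qp.
apply: (@le_trans _ _ (1 + Q x x * Q x x)).
  exact: le_1Dsqr.
rewrite lerD2l; apply: (@le_trans _ _ (\sum_z Q x z * Q z x)).
  rewrite (bigD1 x) //= lerDl; apply: sumr_ge0 => z _.
  by rewrite -(psd_conj x z Qp) mulcJ_ge0.
rewrite (psd_sqrt_diag x Qp QA); apply: ler_sum => z _.
by rewrite lerXn2r ?nnegrE // (le_trans _ (AM z x)).
Qed.

Lemma trace_norm_scale A (c r : R) : 0 <= c -> is_trace_norm A r ->
  is_trace_norm (fun x y => c%:C%C * A x y) (c * r).
Proof.
move=> c0 [Q [Qp [QA Qtr]]]; exists (fun x y => c%:C%C * Q x y); split; last split.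
- move=> v; have := mulr_ge0 (_ : 0 <= c%:C%C) (Qp v); rewrite ler0c => /(_ c0).
  congr (0 <= _); rewrite mulr_sumr; apply: eq_bigr => x _; rewrite mulr_sumr.
  by apply: eq_bigr => y _; ring.
- move=> x y; transitivity (c%:C%C ^+ 2 * opmul Q Q x y).
    by rewrite /opmul mulr_sumr; apply: eq_bigr => z _; ring.
  rewrite QA /opmul mulr_sumr; apply: eq_bigr => z _.
  by rewrite /adj conjcM conjc_real; ring.
- by rewrite -mulr_sumr Qtr !complexr0 -rmorphM.
Qed.

End PositiveSemidefinite.

(** * Block channels *)

Section BlockChannels.
Variables (R : realType) (T I : finType) (p : I -> op R T) (d : I -> R).
Hypothesis pM : forall i j x y, opmul (p i) (p j) x y = (i == j)%:R * p i x y.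
Hypothesis pH : forall i x y, conjc (p i x y) = p i y x.
Hypothesis ptr : forall i, optr (p i) = (d i)%:C%C.
Hypothesis d_gt0 : forall i, 0 < d i.

(** Measure-and-prepare form: the outcome [j] of a measurement by the projectors contributes the
    unnormalised state [p i] with weight [k i j]. *)
Definition block_chan (k : I -> I -> R) : chan R T := fun X x y =>
  \sum_i \sum_j (k i j)%:C%C * pairing (p j) X * p i x y.

Definition block_op (y : I -> R) : op R T := fun a b => \sum_i (y i)%:C%C * p i a b.

Lemma projM i x y : \sum_c p i x c * p i c y = p i x y.
Proof. by have := pM i i x y; rewrite /opmul eqxx mul1r. Qed.

Lemma pairing_proj i j : pairing (p i) (p j) = (i == j)%:R * (d i)%:C%C.
Proof. by rewrite pairingE /optr; under eq_bigr do rewrite pM; rewrite -mulr_sumr -ptr. Qed.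

Lemma pairing_proj_quad i (X : op R T) :
  \sum_e \sum_a \sum_b conjc (p i a e) * X a b * p i b e = pairing (p i) X.
Proof.
rewrite pairingC /pairing exchange_big; apply: eq_bigr => a _.
rewrite exchange_big; apply: eq_bigr => b _; rewrite -projM mulr_sumr.
by apply: eq_bigr => e _; rewrite pH; ring.
Qed.

Lemma psd_pairing_ge0 i (X : op R T) : psd X -> 0 <= pairing (p i) X.
Proof.
by move=> Xp; rewrite -pairing_proj_quad; apply: sumr_ge0 => e _; apply: Xp.
Qed.

(** The columns of the projectors serve as Kraus vectors: since a projector is its own square, both
    [p i] and the trace against [p j] split over columns, and the channel becomes a nonnegative sum
    of [cp_rank1] maps. *)
Lemma block_chan_cp k : (forall i j, 0 <= k i j) -> is_cp (block_chan k).
Proof.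
move=> k0.
suff -> : block_chan k = (fun X x y => \sum_i (fun X x y => \sum_j
  chan_scale (k i j) (fun X x y => \sum_c (fun X x y => \sum_e
    (fun (X : op R T) x y => p i x c * conjc (p i y c) *
       \sum_a \sum_b conjc (p j a e) * X a b * p j b e) X x y) X x y) X x y) X x y).
  apply: cp_sum => i; apply: cp_sum => j; apply: cp_scale => //.
  apply: cp_sum => c; apply: cp_sum => e; exact: cp_rank1.
apply/funext => X; apply/funext => x; apply/funext => y.
apply: eq_bigr => i _; apply: eq_bigr => j _; rewrite /chan_scale complexr0 -mulrA.
congr (_ * _); rewrite -pairing_proj_quad -[p i x y]projM mulr_sumr; apply: eq_bigr => c _.
rewrite mulr_suml; apply: eq_bigr => e _; rewrite pH; ring.
Qed.

Lemma block_op_mul y z a b :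
  opmul (block_op y) (block_op z) a b = block_op (fun i => y i * z i) a b.
Proof.
rewrite /opmul /block_op.
transitivity (\sum_i \sum_j (y i)%:C%C * (z j)%:C%C * opmul (p i) (p j) a b).
  under eq_bigr => c _ do rewrite mulr_suml.
  rewrite exchange_big; apply: eq_bigr => i _.
  under eq_bigr => c _ do rewrite mulr_sumr.
  rewrite exchange_big; apply: eq_bigr => j _; rewrite /opmul mulr_sumr.
  by apply: eq_bigr => c _; ring.
apply: eq_bigr => i _; rewrite (bigD1 i) //= big1 ?addr0.
  by rewrite pM eqxx mul1r rmorphM.
by move=> j ji; rewrite pM eq_sym (negbTE ji) mul0r mulr0.
Qed.

Lemma adj_block_op y : adj (block_op y) = block_op y.
Proof.
apply/funext => a; apply/funext => b; rewrite /adj /block_op rmorph_sum.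
by apply: eq_bigr => i _; rewrite /= conjcM conjc_real pH.
Qed.

Lemma block_op_psd y : (forall i, 0 <= y i) -> psd (block_op y).
Proof.
move=> y0 v.
suff -> : \sum_a \sum_b conjc (v a) * block_op y a b * v b =
  \sum_i (y i)%:C%C * \sum_c (\sum_b p i c b * v b) * conjc (\sum_b p i c b * v b).
  apply: sumr_ge0 => i _; rewrite mulr_ge0 ?ler0c //; apply: sumr_ge0 => c _.
  exact: mulcJ_ge0.
transitivity (\sum_i \sum_a \sum_b (y i)%:C%C * (conjc (v a) * p i a b * v b)).
  rewrite [RHS]exchange_big; apply: eq_bigr => a _; rewrite [RHS]exchange_big.
  apply: eq_bigr => b _; rewrite /block_op mulr_sumr mulr_suml; apply: eq_bigr => i _.
  by ring.
apply: eq_bigr => i _; rewrite mulr_sumr.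
under [RHS]eq_bigr => c _ do rewrite rmorph_sum mulr_sumr mulr_sumr.
rewrite [RHS]exchange_big; apply: eq_bigr => a _ /=.
under [RHS]eq_bigr => c _ do rewrite mulr_suml mulr_sumr.
rewrite [RHS]exchange_big; apply: eq_bigr => b _ /=.
rewrite -projM mulr_sumr mulr_suml mulr_sumr; apply: eq_bigr => c _.
by rewrite conjcM pH; ring.
Qed.

Lemma optr_block_op y : optr (block_op y) = (\sum_i y i * d i)%:C%C.
Proof.
rewrite /optr /block_op exchange_big rmorph_sum; apply: eq_bigr => i _.
by rewrite -mulr_sumr rmorphM /= -ptr.
Qed.

Lemma pairing_block_op i y : pairing (p i) (block_op y) = (y i * d i)%:C%C.
Proof.
rewrite pairing_sumr (bigD1 i) //= big1 ?addr0.
  by rewrite pairingZr pairing_proj eqxx mul1r -rmorphM.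
by move=> l li; rewrite pairingZr pairing_proj eq_sym (negbTE li) mul0r mulr0.
Qed.

Lemma block_chan_op k y :
  block_chan k (block_op y) = block_op (fun i => \sum_j k i j * (y j * d j)).
Proof.
apply/funext => a; apply/funext => b; apply: eq_bigr => i _.
rewrite -mulr_suml rmorph_sum; congr (_ * _); apply: eq_bigr => j _.
by rewrite pairing_block_op -rmorphM.
Qed.

(** Even positivity fails, so a one-dimensional ancilla is enough: the image of the positive [p j]
    pairs with [p i] to [k i j * d j * d i]. *)
Lemma block_chan_not_cp k i j : k i j < 0 -> ~ is_cp (block_chan k).
Proof.
move=> kij /(_ 1%N (fun u v => p j u.1 v.1)) h.
have p_block l : p l = block_op (fun m => (m == l)%:R).
  apply/funext => a; apply/funext => b; rewrite /block_op (bigD1 l) //= big1 ?addr0.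
    by rewrite eqxx rmorph1 mul1r.
  by move=> m /negbTE ->; rewrite rmorph0 mul0r.
have pj_psd : psd (p j) by rewrite p_block; apply: block_op_psd => l; case: eqP.
have psd1 (X : op R T) : psd X -> psd (fun u v : T * 'I_1 => X u.1 v.1).
  move=> Xp v; have := Xp (fun x => v (x, ord0)); congr (0 <= _).
  rewrite sum_pair; apply: eq_bigr => x _; rewrite big_ord1 sum_pair.
  by apply: eq_bigr => y _; rewrite big_ord1.
have {}h := h (psd1 _ pj_psd).
have /(psd_pairing_ge0 i) : psd (block_chan k (p j)).
  move=> v; have := h (fun u => v u.1); congr (0 <= _).
  rewrite sum_pair; apply: eq_bigr => x _; rewrite big_ord1 sum_pair.
  by apply: eq_bigr => y _; rewrite big_ord1.
rewrite (p_block j) block_chan_op pairing_block_op ler0c (bigD1 j) //= big1 ?addr0.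
  by rewrite eqxx mul1r leNgt pmulr_llt0 // pmulr_llt0 // kij.
by move=> l /negbTE ->; rewrite mul0r mulr0.
Qed.

Lemma block_chan_diamond_bounded k : exists2 K : R, 0 <= K &
  forall (X : op R (T * T)%type) (r s : R), is_trace_norm X r -> r <= 1 ->
  is_trace_norm (tens_id (B := T) (block_chan k) X) s -> s <= K.
Proof.
(* [B] bounds the entries of an input of trace norm at most 1, [M] those of its image, and [K] is
   what [trace_norm_bound] makes of [M]. *)
pose B : R[i] := 1 + \sum_(z : T * T) 2.
pose M : R[i] := \sum_x \sum_y \sum_i \sum_j
  `|(k i j)%:C%C| * (\sum_a \sum_b `|p j a b| * B) * `|p i x y|.
pose K : R[i] := \sum_(x : T * T) (1 + \sum_(z : T * T) M ^+ 2).
have B0 : 0 <= B by rewrite addr_ge0 // sumr_ge0.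
have term0 x y i j :
    0 <= `|(k i j)%:C%C| * (\sum_a \sum_b `|p j a b| * B) * `|p i x y|.
  rewrite !mulr_ge0 //; apply: sumr_ge0 => a _; apply: sumr_ge0 => b _.
  by rewrite mulr_ge0.
have M0 : 0 <= M by do 4![apply: sumr_ge0 => ? _].
have K0 : 0 <= K.
  by apply: sumr_ge0 => x _; rewrite addr_ge0 // sumr_ge0 // => z _; rewrite exprn_ge0.
have KE : K = (complex.Re K)%:C%C.
  by apply/eqP; rewrite eq_complex /= eqxx /=; apply/eqP/ger0_Im.
exists (complex.Re K); first by rewrite -ler0c -KE.
move=> X r s Xr r1 Ys; rewrite -lecR -KE.
apply: trace_norm_bound Ys _ => u v.
apply: (@le_trans _ _ (\sum_i \sum_j
  `|(k i j)%:C%C| * (\sum_a \sum_b `|p j a b| * B) * `|p i u.1 v.1|)).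
  rewrite /tens_id /block_chan; apply: le_trans (ler_norm_sum _ _ _) _.
  apply: ler_sum => i _; apply: le_trans (ler_norm_sum _ _ _) _.
  apply: ler_sum => j _; rewrite !normrM; apply: ler_wpM2r => //.
  apply: ler_wpM2l => //; apply: le_trans (ler_norm_sum _ _ _) _.
  apply: ler_sum => a _; apply: le_trans (ler_norm_sum _ _ _) _.
  apply: ler_sum => b _; rewrite normrM; apply: ler_wpM2l => //.
  exact: (trace_norm_entry_bound _ _ Xr r1).
rewrite /M (bigD1 u.1) //= (bigD1 v.1) //= -!addrA lerDl addr_ge0 //.
  by do 3![apply: sumr_ge0 => ? _].
by do 4![apply: sumr_ge0 => ? _].
Qed.

(** Tensoring with |b><b| supplies inputs on the doubled space without changing the trace norm; the
    square root required by the definition is the block operator with coefficients [|y i|]. *)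
Lemma block_op_trace_norm (b : T) y :
  is_trace_norm (fun u v : T * T => block_op y u.1 v.1 * (u.2 == b)%:R * (v.2 == b)%:R)
    (\sum_i `|y i| * d i).
Proof.
pose ext (A : op R T) : op R (T * T)%type :=
  fun u v => A u.1 v.1 * (u.2 == b)%:R * (v.2 == b)%:R.
have extM A A' u v : opmul (ext A) (ext A') u v = ext (opmul A A') u v.
  rewrite /opmul sum_pair /ext -mulrA mulr_suml; apply: eq_bigr => x _ /=.
  rewrite (bigD1 b) //= eqxx big1 ?addr0; first by rewrite /=; ring.
  by move=> z /negbTE ->; rewrite !(mulr0, mul0r).
have ext_adj A : adj (ext A) = ext (adj A).
  apply/funext => u; apply/funext => v; rewrite /adj /ext !conjcM !conjc_nat; ring.
exists (ext (block_op (fun i => `|y i|))); split; last split.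
- move=> v; have := block_op_psd (fun i => normr_ge0 (y i)) (fun x => v (x, b)).
  congr (0 <= _).
  rewrite sum_pair; apply: eq_bigr => x _; rewrite [RHS](bigD1 b) //= [X in _ = _ + X]big1 ?addr0.
    rewrite [RHS]sum_pair; apply: eq_bigr => z _; rewrite (bigD1 b) //= big1 ?addr0.
      by rewrite /ext /= eqxx !mulr1.
    by move=> c /negbTE cb; rewrite /ext /= cb !(mulr0, mul0r).
  by move=> c /negbTE cb; apply: big1 => q _; rewrite /ext /= cb !(mulr0, mul0r).
- move=> u v; rewrite -/(ext (block_op y)) ext_adj adj_block_op !extM.
  rewrite /ext !block_op_mul; congr (_ * _ * _); apply: eq_bigr => i _.
  by congr (_%:C%C * _); rewrite -expr2 real_normK ?num_real // expr2.
- rewrite complexr0 -optr_block_op sum_pair; apply: eq_bigr => x _.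
  rewrite (bigD1 b) //= big1 ?addr0; first by rewrite /ext /= eqxx !mulr1.
  by move=> c /negbTE cb; rewrite /ext /= cb !(mulr0, mul0r).
Qed.

Lemma tens_id_block_op (b : T) k y :
  tens_id (B := T) (block_chan k)
    (fun u v => block_op y u.1 v.1 * (u.2 == b)%:R * (v.2 == b)%:R) =
  fun u v => block_chan k (block_op y) u.1 v.1 * (u.2 == b)%:R * (v.2 == b)%:R.
Proof.
apply/funext => u; apply/funext => v; rewrite /tens_id /block_chan /= -mulrA mulr_suml.
apply: eq_bigr => i _; rewrite mulr_suml; apply: eq_bigr => j _.
suff -> : pairing (p j) (fun a a' => block_op y a a' * (u.2 == b)%:R * (v.2 == b)%:R) =
  (u.2 == b)%:R * (v.2 == b)%:R * pairing (p j) (block_op y) by ring.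
rewrite -pairingZr; congr pairing; apply/funext => a; apply/funext => a'; ring.
Qed.

End BlockChannels.

(** * Haar moments as projections onto commutants *)

Section Tensor.
Variables (R : realType) (N : nat).
Implicit Types U V : Mt R N.

Lemma tens2_opmul U V : tens2 (opmul U V : Mt R N) = opmul (tens2 U) (tens2 V).
Proof.
apply/funext => x; apply/funext => y; rewrite /tens2 /opmul sum_pair mulr_suml.
apply: eq_bigr => a _; rewrite mulr_sumr; apply: eq_bigr => b _ /=; ring.
Qed.

Lemma tens2_adj U : tens2 (adj U : Mt R N) = adj (tens2 U).
Proof. by apply/funext => x; apply/funext => y; rewrite /adj /tens2 conjcM. Qed.

Lemma tens2_idop : tens2 (@idop R (qb N) : Mt R N) = @idop R _.
Proof.
apply/funext => -[x1 x2]; apply/funext => -[y1 y2]; rewrite /tens2 /idop /=.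
by rewrite -natrM mulnb -xpair_eqE.
Qed.

Lemma tens2_unitary U : Defs.is_unitary U ->
  opmul (adj (tens2 U)) (tens2 U) = @idop R _ /\
  opmul (tens2 U) (adj (tens2 U)) = @idop R _.
Proof.
move=> Uu; rewrite -tens2_adj -!tens2_opmul -tens2_idop; split; congr tens2;
by apply/funext => x; apply/funext => y; have [] := Uu x y.
Qed.

Definition commutant (S : {set 'I_N}) (Y : op R (qb N * qb N)%type) : Prop :=
  forall V : Mt R N, local_unitaries S V -> opmul (tens2 V) Y = opmul Y (tens2 V).

(** These two properties determine the map ([twirl_unique]): it is the orthogonal projection onto
    the commutant. They are all that is retained of the Haar measure. *)
Definition is_twirl (S : {set 'I_N}) (Phi : chan R (qb N * qb N)%type) : Prop :=
  (forall X, commutant S (Phi X)) /\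
  (forall X Z, commutant S Z -> pairing (Phi X) Z = pairing X Z).

Lemma local_unitaries_adj (S : {set 'I_N}) U :
  local_unitaries S U -> local_unitaries S (adj U : Mt R N).
Proof.
move=> [Uu [V [Vdep UV]]]; split.
  by move=> x y; rewrite adjK; have [] := Uu x y.
exists (adj V); split => [x y x' y' xx yy|x y].
  by rewrite /adj (Vdep _ _ _ _ yy xx).
rewrite /adj UV conjcM conjc_nat; congr ((nat_of_bool _)%:R * _).
by apply: eq_forallb => i; rewrite [x i == _]eq_sym.
Qed.

End Tensor.

(** * Integration against a Haar measure on local unitaries *)

Section HaarTwirl.
Variables (R : realType) (N : nat).
Implicit Types f g : MT R N -> R[i].

Definition cmeasurable f := measurable_fun [set: MT R N] (fun U => complex.Re (f U)) /\
  measurable_fun [set: MT R N] (fun U => complex.Im (f U)).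

Lemma cmeasurable_entry x y : cmeasurable (fun U => U x y).
Proof.
by split => _ A mA; rewrite setTI; apply: sub_sigma_algebra; exists x, y, A; split; auto.
Qed.

Lemma cmeasurable_cst c : cmeasurable (fun _ => c).
Proof. by split; exact: measurable_cst. Qed.

Lemma cmeasurableD f g : cmeasurable f -> cmeasurable g -> cmeasurable (fun U => f U + g U).
Proof.
move=> [f1 f2] [g1 g2]; split.
  rewrite (_ : (fun U => _) = (fun U => complex.Re (f U) + complex.Re (g U))).
    exact: measurable_funD.
  by apply/funext => U; case: (f U) (g U) => [? ?] [].
rewrite (_ : (fun U => _) = (fun U => complex.Im (f U) + complex.Im (g U))).
  exact: measurable_funD.
by apply/funext => U; case: (f U) (g U) => [? ?] [].
Qed.

Lemma cmeasurableM f g : cmeasurable f -> cmeasurable g -> cmeasurable (fun U => f U * g U).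
Proof.
move=> [f1 f2] [g1 g2]; split.
  rewrite (_ : (fun U => _) = (fun U => complex.Re (f U) * complex.Re (g U)
      - complex.Im (f U) * complex.Im (g U))).
    by apply: measurable_funB; exact: measurable_funM.
  by apply/funext => U; case: (f U) (g U) => [? ?] [].
rewrite (_ : (fun U => _) = (fun U => complex.Re (f U) * complex.Im (g U)
    + complex.Im (f U) * complex.Re (g U))).
  by apply: measurable_funD; exact: measurable_funM.
by apply/funext => U; case: (f U) (g U) => [? ?] [].
Qed.

Lemma cmeasurable_conj f : cmeasurable f -> cmeasurable (fun U => conjc (f U)).
Proof.
move=> [f1 f2]; split.
  by rewrite (_ : (fun U => _) = (fun U => complex.Re (f U))) //; apply/funext => U; case: (f U).
rewrite (_ : (fun U => _) = (fun U => - complex.Im (f U))); first exact: measurable_funN.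
by apply/funext => U; case: (f U).
Qed.

Lemma cmeasurable_sum (I : finType) (f : I -> MT R N -> R[i]) :
  (forall i, cmeasurable (f i)) -> cmeasurable (fun U => \sum_i f i U).
Proof.
move=> fm; elim: (index_enum I) => [|i s ih].
  by under eq_fun do rewrite big_nil; exact: cmeasurable_cst.
by under eq_fun do rewrite big_cons; apply: cmeasurableD.
Qed.

Lemma measurable_ceq f g : cmeasurable f -> cmeasurable g ->
  measurable [set U : MT R N | f U = g U].
Proof.
move=> fm gm.
have [h1 h2] := cmeasurableD fm (cmeasurableM (cmeasurable_cst (-1)) gm).
rewrite (_ : [set _ | _] = (fun U => complex.Re (f U + -1 * g U)) @^-1` [set 0] `&`
  (fun U => complex.Im (f U + -1 * g U)) @^-1` [set 0]).
  apply: measurableI; rewrite -[X in measurable X]setTI.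
    exact: h1.
  exact: h2.
apply/seteqP; split => U /=; rewrite mulN1r.
  by move=> ->; rewrite subrr.
move=> [e1 e2]; apply/eqP; rewrite -subr_eq0 eq_complex /=.
by rewrite e1 e2 !eqxx.
Qed.

Lemma measurable_finforall (I : finType) (F : I -> set (MT R N)) :
  (forall i, measurable (F i)) -> measurable [set U | forall i, F i U].
Proof.
move=> mF; rewrite (_ : [set _ | _] = \bigcap_(i in [set: I]) F i).
  by apply: fin_bigcap_measurable => // ; exact: finite_finset.
by apply/seteqP; split => U /= h i; [move=> _|]; apply: h.
Qed.

Definition mask_on (S : {set 'I_N}) (x : qb N) : qb N := [ffun i => (i \in S) && x i].

(** Replaces the existential over [V] by finitely many equations between entries of [U], which makes
    the set of local unitaries measurable. *)
Lemma acts_withinE (S : {set 'I_N}) (U : Mt R N) : acts_within S U <->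
  forall x y, U x y = ([forall i in ~: S, x i == y i])%:R * U (mask_on S x) (mask_on S y).
Proof.
split => [[V [Vdep UV]] x y|UE].
  rewrite [U x y]UV; congr (_ * _); rewrite UV.
  rewrite [X in (nat_of_bool X)%:R](_ : _ = true) ?mul1r.
    apply: Vdep; apply/forallP => i; apply/implyP => iS; rewrite ffunE iS //.
  by apply/forallP => i; apply/implyP; rewrite inE !ffunE => /negbTE ->.
exists (fun x y => U (mask_on S x) (mask_on S y)); split => // x y x' y' /forallP xx /forallP yy.
congr (U _ _); apply/ffunP => i; rewrite !ffunE.
  by have /implyP := xx i; case: (i \in S) => // /(_ isT) /eqP ->.
by have /implyP := yy i; case: (i \in S) => // /(_ isT) /eqP ->.
Qed.

Lemma measurable_local_unitaries (S : {set 'I_N}) :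
  measurable (@local_unitaries R N S).
Proof.
rewrite (_ : local_unitaries S = [set U : MT R N | forall x, forall y,
    opmul (adj U) U x y = @idop R _ x y] `&` [set U : MT R N | forall x, forall y,
    opmul U (adj U) x y = @idop R _ x y] `&` [set U : MT R N | forall x, forall y,
    U x y = ([forall i in ~: S, x i == y i])%:R * U (mask_on S x) (mask_on S y)]).
  apply: measurableI; [apply: measurableI|]; apply: measurable_finforall => x;
    apply: measurable_finforall => y; apply: measurable_ceq;
    rewrite /opmul /adj; repeat first [exact: cmeasurable_cst | exact: cmeasurable_entry
    | apply: cmeasurable_sum => ? | apply: cmeasurableM | apply: cmeasurable_conj].
apply/seteqP; split => U /=.
  move=> [Uu Ua]; split; last exact/acts_withinE.
  by split => x y; have [] := Uu x y.
by move=> [[h1 h2] /acts_withinE h3]; split => // x y; split.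
Qed.

Lemma measurable_opmull (V : Mt R N) :
  measurable_fun [set: MT R N] (fun U : MT R N => opmul V U : MT R N).
Proof.
have := @measurability _ _ (MT R N) (MT R N) setT (fun U => opmul V U) (@entry_sets R N).
apply => //.
move=> ? [? [x [y [A [mA e]]]] <-].
have [h1 h2] : cmeasurable (fun U => opmul V U x y).
  apply: cmeasurable_sum => z; apply: cmeasurableM.
    exact: cmeasurable_cst.
  exact: cmeasurable_entry.
by case: e => ->; [exact: h1|exact: h2].
Qed.

Section Expectation.
Variables (S : {set 'I_N}) (mu : probability (MT R N) R).
Hypothesis muL : mu (@local_unitaries R N S) = 1%E.
Let L := @local_unitaries R N S.
Let mL : measurable L := @measurable_local_unitaries S.

Lemma mu_setCL : mu (~` L) = 0%E.
Proof. by rewrite probability_setC // muL subee. Qed.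

(** Entries are unbounded on the whole operator space but at most 1 in modulus on unitaries. Asking
    for a bound on [L] alone, a set of full measure, yields a class of integrable functions closed
    under sums, products and conjugation. *)
Definition tame f := cmeasurable f /\ exists M : R[i], forall U, L U -> `|f U| <= M.

Lemma tame_integrable f : tame f ->
  mu.-integrable [set: MT R N] (EFin \o (fun U => complex.Re (f U))) /\
  mu.-integrable [set: MT R N] (EFin \o (fun U => complex.Im (f U))).
Proof.
move=> [[f1 f2] [M fM]].
have key (h : MT R N -> R) : measurable_fun [set: MT R N] h ->
    (forall U, L U -> `|h U| <= complex.Re M) ->
    mu.-integrable [set: MT R N] (EFin \o h).
  move=> hm hb; apply/(@negligible_integrable _ _ _ mu _ (~` L)) => //.
  - exact: measurableC.
  - exact/measurable_EFinP.
  - exact: mu_setCL.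
  rewrite setTD setCK; apply: measurable_bounded_integrable => //.
  - by apply: le_lt_trans (probability_le1 mu mL) _; rewrite ltry.
  - exact: measurable_funTS.
  exists (complex.Re M); split; first exact: num_real.
  by move=> x Mx U LU /=; apply: le_trans (hb U LU) (ltW Mx).
have M_ge U : L U -> complex.Re (`|f U|) <= complex.Re M.
  by move=> /fM; rewrite lecE => /andP[].
split; apply: key => // U LU; apply: le_trans (M_ge U LU); rewrite normc_def /=.
  by rewrite -sqrtr_sqr ler_sqrt ?addr_ge0 ?sqr_ge0 // lerDl sqr_ge0.
by rewrite -sqrtr_sqr ler_sqrt ?addr_ge0 ?sqr_ge0 // lerDr sqr_ge0.
Qed.

Lemma tame_cst c : tame (fun _ => c).
Proof. by split; [exact: cmeasurable_cst|exists `|c|]. Qed.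

Lemma tameD f g : tame f -> tame g -> tame (fun U => f U + g U).
Proof.
move=> [fm [M fM]] [gm [K gK]]; split; first exact: cmeasurableD.
by exists (M + K) => U LU; rewrite (le_trans (ler_normD _ _)) // lerD ?fM ?gK.
Qed.

Lemma tameM f g : tame f -> tame g -> tame (fun U => f U * g U).
Proof.
move=> [fm [M fM]] [gm [K gK]]; split; first exact: cmeasurableM.
by exists (M * K) => U LU; rewrite normrM ler_pM ?fM ?gK.
Qed.

Lemma tame_conj f : tame f -> tame (fun U => conjc (f U)).
Proof.
move=> [fm [M fM]]; split; first exact: cmeasurable_conj.
by exists M => U LU; rewrite normcJ fM.
Qed.

Lemma tame_sum (I : finType) (f : I -> MT R N -> R[i]) :
  (forall i, tame (f i)) -> tame (fun U => \sum_i f i U).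
Proof.
move=> fm; elim: (index_enum I) => [|i s ih].
  by under eq_fun do rewrite big_nil; exact: tame_cst.
by under eq_fun do rewrite big_cons; apply: tameD.
Qed.

Lemma tame_entry x y : tame (fun U => U x y).
Proof.
split; first exact: cmeasurable_entry.
exists 1 => U [Uu _]; have [+ _] := Uu y y; rewrite /opmul /adj /idop eqxx => e.
rewrite -(@expr_le1 _ 2) // -[leRHS]/(true%:R) -e (bigD1 x) //= sqr_normc mulrC lerDl.
by apply: sumr_ge0 => z _; rewrite mulrC mulcJ_ge0.
Qed.

Lemma cexpD f g : tame f -> tame g -> cexp mu (fun U => f U + g U) = cexp mu f + cexp mu g.
Proof.
move=> /tame_integrable[f1 f2] /tame_integrable[g1 g2]; rewrite /cexp.
apply/eqP; rewrite eq_complex /=; apply/andP; split; apply/eqP.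
  by rewrite -RintegralD //; apply: eq_Rintegral => U _; case: (f U) (g U) => [? ?] [].
by rewrite -RintegralD //; apply: eq_Rintegral => U _; case: (f U) (g U) => [? ?] [].
Qed.

Lemma cexpZ c f : tame f -> cexp mu (fun U => c * f U) = c * cexp mu f.
Proof.
move=> /tame_integrable[f1 f2]; rewrite /cexp.
have Z (a : R) (h : MT R N -> R) : mu.-integrable setT (EFin \o h) ->
    mu.-integrable setT (EFin \o (fun U => a * h U)).
  by move=> hi; have := integrableZl measurableT a hi; apply: eq_integrable.
case: c => a b; apply/eqP; rewrite eq_complex /=; apply/andP; split; apply/eqP.
  rewrite -!RintegralZl // -RintegralB //; try exact: Z.
  by apply: eq_Rintegral => U _; case: (f U).
rewrite -!RintegralZl // -RintegralD //; try exact: Z.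
by apply: eq_Rintegral => U _; case: (f U).
Qed.

Lemma cexp_sum (I : finType) (f : I -> MT R N -> R[i]) :
  (forall i, tame (f i)) -> cexp mu (fun U => \sum_i f i U) = \sum_i cexp mu (f i).
Proof.
move=> ft; elim: (index_enum I) => [|i s ih].
  rewrite big_nil; under eq_fun do rewrite big_nil.
  by rewrite -[RHS](mul0r (cexp mu (fun=> 0))) -cexpZ ?mul0r //; exact: tame_cst.
rewrite big_cons -ih -cexpD //.
  by congr cexp; apply/funext => U; rewrite big_cons.
elim: s {ih} => [|j s ih]; first by under eq_fun do rewrite big_nil; exact: tame_cst.
by under eq_fun do rewrite big_cons; apply: tameD.
Qed.

Lemma cexp_ae f g : tame f -> tame g -> (forall U, L U -> f U = g U) -> cexp mu f = cexp mu g.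
Proof.
move=> [[f1 f2] _] [[g1 g2] _] fg.
have ae (h k : MT R N -> R) : measurable_fun setT h -> measurable_fun setT k ->
    (forall U, L U -> h U = k U) -> Rintegral mu setT h = Rintegral mu setT k.
  move=> hm km hk; congr fine; apply: ae_eq_integral => //; try exact/measurable_EFinP.
  exists (~` L); split; [exact: measurableC|exact: mu_setCL|].
  by move=> U /=; apply: contra_not => LU _; rewrite (hk U LU).
rewrite /cexp; congr Complex; apply: ae => // U LU; by rewrite fg.
Qed.

Lemma cexp_cst c : cexp mu (fun _ => c) = c.
Proof.
rewrite /cexp !Rintegral_cst //.
have e : fine (mu setT) = 1 by rewrite probability_setT.
transitivity (Complex (complex.Re c * fine (mu setT)) (complex.Im c * fine (mu setT))) => //.
by rewrite e !mulr1; case: c.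
Qed.

Lemma cexp_left_invariant (V : Mt R N) f : 
  (forall A : set (MT R N), measurable A -> mu [set U | A (opmul V U)] = mu A) ->
  tame f -> tame (fun U => f (opmul V U)) -> cexp mu (fun U => f (opmul V U)) = cexp mu f.
Proof.
move=> inv [[f1 f2] _] tfV; have [i1 i2] := tame_integrable tfV.
have mV := measurable_opmull V.
have key (h : MT R N -> R) : measurable_fun setT h ->
    mu.-integrable setT (EFin \o (fun U => h (opmul V U))) ->
    Rintegral mu setT (fun U => h (opmul V U)) = Rintegral mu setT h.
  move=> hm hi; congr fine.
  transitivity (\int[pushforward mu (fun U : MT R N => opmul V U : MT R N)]_U (h U)%:E)%E.
    have := @integral_pushforward _ _ _ _ R _ mV mu setT (EFin \o h).
    by rewrite preimage_setT => ->//; exact/measurable_EFinP.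
  by apply: eq_measure_integral => A mA _; exact: inv.
by rewrite /cexp; congr Complex; [exact: (key _ f1 i1)|exact: (key _ f2 i2)].
Qed.

End Expectation.

Lemma tame_conjugation (S : {set 'I_N}) (X : op R (qb N * qb N)%type) (V : Mt R N) a b :
  tame S (fun U => opmul (opmul (tens2 (opmul V U : Mt R N)) X)
    (adj (tens2 (opmul V U : Mt R N))) a b).
Proof.
rewrite /opmul /adj /tens2; repeat first [exact: tame_cst | exact: tame_entry
  | apply: tame_sum => ? | apply: tameM | apply: tame_conj].
Qed.

(** Left invariance absorbs a conjugation by [V] into the integration variable, which places the
    range in the commutant. For [Z] in the commutant, cyclicity of the trace makes the integrand
    constant on local unitaries, equal to tr (X Z). *)
Lemma haar_twirl (S : {set 'I_N}) (mu : probability (MT R N) R) :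
  is_haar S mu -> is_twirl S (moment2 mu).
Proof.
move=> [muL inv].
have tame1 X a b : tame S (fun U => opmul (opmul (tens2 U) X) (adj (tens2 U)) a b).
  have := tame_conjugation S X (@idop R _) a b.
  by under eq_fun do rewrite opmul1l.
split => [X V LV|X Z ZW].
  have [V1 V2] := tens2_unitary LV.1.
  suff e : opmul (opmul (tens2 V) (moment2 mu X)) (adj (tens2 V)) = moment2 mu X.
    by rewrite -[in RHS]e -!opmulA V1 opmul1r.
  apply/funext => a; apply/funext => b.
  rewrite [RHS]/moment2.
  rewrite -(cexp_left_invariant muL (fun A mA => (inv V LV A mA).1)
    (tame1 X a b) (tame_conjugation S X V a b)).
  transitivity (cexp mu (fun U => \sum_z \sum_w tens2 V a w * conjc (tens2 V b z) *
     opmul (opmul (tens2 U) X) (adj (tens2 U)) w z)).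
    rewrite (cexp_sum muL) => [|z]; last first.
      by apply: tame_sum => w; apply: tameM => //; exact: tame_cst.
    apply: eq_bigr => z _; rewrite (cexp_sum muL) => [|w]; last first.
      by apply: tameM => //; exact: tame_cst.
    rewrite mulr_suml; apply: eq_bigr => w _.
    by rewrite (cexpZ muL) // /adj mulrAC.
  congr cexp; apply/funext => U.
  rewrite tens2_opmul adj_opmul.
  transitivity (opmul (opmul (tens2 V) (opmul (opmul (tens2 U) X) (adj (tens2 U))))
    (adj (tens2 V)) a b); last by rewrite !opmulA.
  apply: eq_bigr => z _; rewrite [in RHS]/opmul mulr_suml; apply: eq_bigr => w _.
  by rewrite /adj mulrAC.
transitivity (cexp mu (fun U => \sum_a \sum_b Z b a *
     opmul (opmul (tens2 U) X) (adj (tens2 U)) a b)).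
  rewrite (cexp_sum muL) => [|a]; last first.
    by apply: tame_sum => b; apply: tameM => //; exact: tame_cst.
  apply: eq_bigr => a _; rewrite (cexp_sum muL) => [|b]; last first.
    by apply: tameM => //; exact: tame_cst.
  by apply: eq_bigr => b _; rewrite (cexpZ muL) // mulrC.
rewrite -[RHS](cexp_cst mu).
apply: (cexp_ae muL) => [||U LU].
- apply: tame_sum => a; apply: tame_sum => b; apply: tameM => //; exact: tame_cst.
- exact: tame_cst.
transitivity (pairing (opmul (opmul (tens2 U) X) (adj (tens2 U))) Z).
  by apply: eq_bigr => a _; apply: eq_bigr => b _; rewrite mulrC.
have [U1 U2] := tens2_unitary LU.1.
by rewrite -opmulA pairing_opmul -ZW // pairingE -opmulA (opmulA (adj _)) U1 opmul1l.
Qed.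

End HaarTwirl.

(** * The commutant of the V (x) V *)

Section InvariantTensors.
Variables (K : fieldType) (L : eqType) (y : L -> L -> L -> L -> K).
Hypothesis K2 : 2 != 0 :> K.
Hypothesis gl : forall i j a b c d,
  (a == i)%:R * y j b c d + (b == i)%:R * y a j c d =
  (c == j)%:R * y a b i d + (d == j)%:R * y a b c i.

(** [gl] says that [y], with rows (a, b) and columns (c, d), commutes with E_ij (x) 1 + 1 (x) E_ij.
    For i = j this compares weights: where [y] is nonzero, [i] occurs equally often among the row
    labels and among the column labels. *)
Lemma invariant_weight i a b c d :
  ((a == i)%:R + (b == i)%:R - (c == i)%:R - (d == i)%:R) * y a b c d = 0.
Proof.
have h (e f : L) (z : L -> K) : (e == f)%:R * z f = (e == f)%:R * z e.
  by case: eqP => [->|_] //; rewrite !mul0r.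
have := gl i i a b c d.
rewrite (h a i (fun t => y t b c d)) (h b i (fun t => y a t c d)).
rewrite (h c i (fun t => y a b t d)) (h d i (fun t => y a b c t)) => e.
by rewrite !mulrBl mulrDl e; ring.
Qed.

Lemma invariant_support a b c d :
  ~~ ((a == c) && (b == d)) -> ~~ ((a == d) && (b == c)) -> y a b c d = 0.
Proof.
have := invariant_weight a a b c d; have := invariant_weight b a b c d.
rewrite !eqxx (eq_sym c a) (eq_sym d a) (eq_sym c b) (eq_sym d b) (eq_sym b a).
have K1 : 1 != 0 :> K by exact: oner_neq0.
case: (eqVneq a b) => [<-|ab].
  case: (a == c); case: (a == d) => //= _ /eqP; rewrite mulf_eq0 => /orP[|/eqP //].
  - by rewrite subr0 addrK (negbTE K1).
  - by rewrite subr0 addrK (negbTE K1).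
  - by rewrite !subr0 (negbTE K2).
case: (eqVneq a c) => [<-|ac]; case: (eqVneq a d) => [<-|ad];
  rewrite ?(eq_sym b a) ?(negbTE ab) /=.
- move=> _ /eqP; rewrite mulf_eq0 addr0 subrr sub0r oppr_eq0 (negbTE K1) /= => /eqP //.
- case: (b == d) => //= /eqP; rewrite mulf_eq0 add0r !subr0 (negbTE K1) /= => /eqP //.
- case: (b == c) => //= /eqP; rewrite mulf_eq0 add0r !subr0 (negbTE K1) /= => /eqP //.
- move=> _ /eqP; rewrite mulf_eq0 addr0 !subr0 (negbTE K1) /= => /eqP //.
Qed.

(** Off-diagonal matrix units rename one label at a time, provided it does not collide with the
    other one; when a collision does occur they produce the relations of [invariant_diag] and its
    variants. *)
Lemma invariant_parallel_l a a' b : a != b -> a' != b -> y a b a b = y a' b a' b.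
Proof.
move=> ab a'b; have [->//|aa'] := eqVneq a a'.
have := gl a a' a b a' b; rewrite !eqxx (eq_sym b a) (eq_sym b a') (negbTE ab) (negbTE a'b).
by rewrite !mul1r !mul0r !addr0 => ->.
Qed.

Lemma invariant_parallel_r a b b' : a != b -> a != b' -> y a b a b = y a b' a b'.
Proof.
move=> ab ab'; have [->//|bb'] := eqVneq b b'.
have := gl b b' a b a b'; rewrite !eqxx (negbTE ab) (negbTE ab').
by rewrite !mul1r !mul0r !add0r => ->.
Qed.

Lemma invariant_crossed_l a a' b : a != b -> a' != b -> y a b b a = y a' b b a'.
Proof.
move=> ab a'b; have [->//|aa'] := eqVneq a a'.
have := gl a a' a b b a'; rewrite !eqxx (eq_sym b a) (eq_sym b a') (negbTE ab) (negbTE a'b).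
by rewrite !mul1r !mul0r addr0 add0r => ->.
Qed.

Lemma invariant_crossed_r a b b' : a != b -> a != b' -> y a b b a = y a b' b' a.
Proof.
move=> ab ab'; have [->//|bb'] := eqVneq b b'.
have := gl b b' a b b' a; rewrite !eqxx (negbTE ab) (negbTE ab').
by rewrite !mul1r !mul0r add0r addr0 => ->.
Qed.

Lemma invariant_diag a b : a != b -> y b b b b = y a b a b + y a b b a.
Proof.
move=> ab; have := gl a b a b b b; rewrite !eqxx (eq_sym b a) (negbTE ab).
by rewrite !mul1r mul0r addr0.
Qed.

Lemma invariant_diag' a b : a != b -> y a a a a = y a b a b + y b a a b.
Proof.
move=> ab; have := gl a b a a a b; rewrite !eqxx (negbTE ab).
by rewrite !mul1r mul0r add0r addrC.
Qed.

Lemma invariant_diag2 a b : a != b -> y a a a a = y a b a b + y a b b a.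
Proof.
move=> ab; have := gl b a a b a a; rewrite !eqxx (negbTE ab).
by rewrite !mul1r mul0r add0r addrC.
Qed.

Lemma invariant_crossed_swap a b : a != b -> y a b b a = y b a a b.
Proof.
move=> ab; have := invariant_diag' ab; rewrite (invariant_diag2 ab).
by move/addrI.
Qed.

Lemma invariant_parallel_swap a b : a != b -> y a b a b = y b a b a.
Proof.
move=> ab; have ba : b != a by rewrite eq_sym.
have := invariant_diag2 ab; rewrite (invariant_diag ba) (invariant_crossed_swap ab).
by move/addIr => ->.
Qed.

(** The coefficients of the identity and of the swap are read off at one reference pair of distinct
    labels; entries with equal row labels are the sum of the two. *)
Lemma invariant_tensor p q a b c d : p != q ->
  y a b c d = ((a == c) && (b == d))%:R * y p q p q + ((a == d) && (b == c))%:R * y p q q p.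
Proof.
move=> pq.
have par a0 b0 : a0 != b0 -> y a0 b0 a0 b0 = y p q p q /\ y a0 b0 b0 a0 = y p q q p.
  move=> ab; have [ap|ap] := eqVneq a0 p.
    rewrite ap in ab *.
    by rewrite (@invariant_parallel_r p b0 q) // (@invariant_crossed_r p b0 q).
  have [bp|bp] := eqVneq b0 p; last first.
    have pb : p != b0 by rewrite eq_sym.
    rewrite (@invariant_parallel_l a0 p b0) // (@invariant_crossed_l a0 p b0) //.
    by rewrite (@invariant_parallel_r p b0 q) // (@invariant_crossed_r p b0 q).
  (* The pair (q, p) needs its own argument: with only two labels, renaming one at a time cannot
     reach (p, q) without a collision, so the exchange goes through the entries with equal
     labels. *)
  rewrite bp in ab *; have [aq|aq] := eqVneq a0 q.
    by rewrite aq -invariant_parallel_swap // -invariant_crossed_swap.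
  rewrite (@invariant_parallel_r a0 p q) // (@invariant_crossed_r a0 p q) //.
  by rewrite (@invariant_parallel_l a0 p q) // (@invariant_crossed_l a0 p q).
have [/andP[/eqP <- /eqP <-]|h1] := boolP ((a == c) && (b == d)).
  have [<-|ab] := eqVneq a b.
    rewrite ?eqxx /= !mul1r; have [aq|aq] := eqVneq a q.
      by rewrite aq (invariant_diag pq).
    have [<- <-] := par a q aq; exact: invariant_diag2.
  by rewrite mul1r mul0r addr0; have [] := par a b ab.
have [/andP[/eqP e1 /eqP e2]|h2] := boolP ((a == d) && (b == c)).
  rewrite -e1 -e2 in h1 *; have ab : a != b.
    by apply: contraNneq h1 => ->; rewrite eqxx.
  by rewrite mul1r mul0r add0r; have [] := par a b ab.
by rewrite !mul0r addr0 invariant_support.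
Qed.

End InvariantTensors.

(** * From local unitaries to local matrix units *)

Section Commutant.
Variables (R : realType) (N : nat) (S : {set 'I_N}).
Local Notation C := R[i].
Local Notation Q2 := (qb N * qb N)%type.

Definition lab := {ffun {i : 'I_N | i \in S} -> bool}.
Definition res (x : qb N) : lab := [ffun i => x (val i)].
Definition mrg (a : lab) (x : qb N) : qb N :=
  [ffun i => if insub i is Some j then a j else x i].

Lemma mrg_in a x (i : {i : 'I_N | i \in S}) : mrg a x (val i) = a i.
Proof. by rewrite ffunE valK. Qed.

Lemma mrg_notin a x i : i \notin S -> mrg a x i = x i.
Proof. by move=> iS; rewrite ffunE insubF //; apply: negbTE. Qed.

Lemma res_mrg a x : res (mrg a x) = a.
Proof. by apply/ffunP => i; rewrite ffunE mrg_in. Qed.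

Lemma mrg_agree a (x x' : qb N) : (forall i, i \notin S -> x i = x' i) -> mrg a x = mrg a x'.
Proof.
move=> h; apply/ffunP => i; have [iS|iS] := boolP (i \in S).
  by rewrite -[ i ]/(val (exist (fun i => i \in S) i iS)) !mrg_in.
by rewrite !mrg_notin // h.
Qed.

Lemma mrg_res x : mrg (res x) x = x.
Proof.
apply/ffunP => i; have [iS|iS] := boolP (i \in S); last by rewrite mrg_notin.
by rewrite -[ i ]/(val (exist (fun i => i \in S) i iS)) mrg_in ffunE.
Qed.

Lemma mrg_mrg a b x : mrg a (mrg b x) = mrg a x.
Proof. by apply: mrg_agree => i iS; rewrite mrg_notin. Qed.

Lemma res_eqP (x y : qb N) : reflect (forall i, i \in S -> x i = y i) (res x == res y).
Proof.
apply: (iffP eqP) => [h i iS|h].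
  by move/ffunP: h => /(_ (exist (fun i => i \in S) i iS)); rewrite !ffunE.
by apply/ffunP => -[i iS]; rewrite !ffunE /= h.
Qed.

Lemma agree_off (x y : qb N) : [forall i in ~: S, x i == y i] = (y == mrg (res y) x).
Proof.
apply/forallP/eqP => [h|-> i].
  rewrite -[LHS]mrg_res; apply: mrg_agree => i iS; apply/esym/eqP.
  by have /implyP := h i; rewrite inE; apply.
by apply/implyP; rewrite inE => iS; rewrite mrg_notin.
Qed.

(** The matrix unit |a><b| on [S] tensored with the identity: [mrg b x] is the one column that
    agrees with [x] off [S] and carries the label [b] on [S]. *)
Definition elem_op (a b : lab) : Mt R N := fun x y => (res x == a)%:R * (y == mrg b x)%:R.

Lemma elopE a b x y : elem_op a b x y =
  ([forall i in ~: S, x i == y i])%:R * ((res x == a)%:R * (res y == b)%:R).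
Proof.
rewrite agree_off /elem_op mulrCA; congr (_ * _).
have [/eqP <-|h] := boolP (res y == b); first by rewrite mulr1.
by rewrite mulr0; case: eqP => // e; rewrite e res_mrg eqxx in h.
Qed.

Lemma elopE' a b x y : elem_op a b x y = (res y == b)%:R * (x == mrg a y)%:R.
Proof.
rewrite elopE; have -> : [forall i in ~: S, x i == y i] = [forall i in ~: S, y i == x i].
  by apply: eq_forallb => i; rewrite eq_sym.
by rewrite -[RHS]/(elem_op b a y x) elopE [X in _ * X = _]mulrC.
Qed.

Lemma elop_adj a b : adj (elem_op a b) = elem_op b a.
Proof.
by apply/funext => x; apply/funext => y; rewrite /adj elopE' conjcM !conjc_nat.
Qed.

Lemma elop_mul a b c d x y : opmul (elem_op a b) (elem_op c d) x y = (b == c)%:R * elem_op a d x y.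
Proof.
rewrite /opmul.
under eq_bigr => z _ do rewrite [elem_op a b x z]/elem_op mulrAC.
rewrite sum_delta_r /elem_op res_mrg mrg_mrg; ring.
Qed.

Lemma elop_local a b : acts_within S (elem_op a b).
Proof.
exists (fun x y => (res x == a)%:R * (res y == b)%:R); split => [x y x' y'|x y].
  move=> /forallP h1 /forallP h2.
  have -> : res x = res x' by apply/eqP/res_eqP => i iS; have /implyP/(_ iS)/eqP := h1 i.
  by have -> : res y = res y' by apply/eqP/res_eqP => i iS; have /implyP/(_ iS)/eqP := h2 i.
exact: elopE.
Qed.

Lemma acts_within_lin (P P' : Mt R N) c c' : acts_within S P -> acts_within S P' ->
  acts_within S (fun x y => c * P x y + c' * P' x y : C).
Proof.
move=> [V [Vd PV]] [V' [Vd' PV']]; exists (fun x y => c * V x y + c' * V' x y).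
split => [x y x' y' hx hy|x y]; first by rewrite (Vd _ _ _ _ hx hy) (Vd' _ _ _ _ hx hy).
by rewrite PV PV'; ring.
Qed.

Lemma acts_within_idop : acts_within S (@idop R (qb N)).
Proof.
exists (fun x y => (res x == res y)%:R); split => [x y x' y'|x y].
  move=> /forallP h1 /forallP h2.
  have -> : res x = res x' by apply/eqP/res_eqP => i iS; have /implyP/(_ iS)/eqP := h1 i.
  by have -> : res y = res y' by apply/eqP/res_eqP => i iS; have /implyP/(_ iS)/eqP := h2 i.
rewrite agree_off /idop -natrM mulnb; congr ((nat_of_bool _)%:R).
apply/eqP/andP => [->|[/eqP e1 /eqP e2]]; first by rewrite mrg_res eqxx.
by rewrite e1 -e2 mrg_res.
Qed.

(** The derivative of V (x) V at the identity in the direction [P], that is P (x) 1 + 1 (x) P. *)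
Definition gen (P : Mt R N) : op R Q2 :=
  fun x y => P x.1 y.1 * (x.2 == y.2)%:R + (x.1 == y.1)%:R * P x.2 y.2.

Lemma tens2_shift (P : Mt R N) c x y :
  tens2 (fun x y => 1 * @idop R _ x y + c * P x y) x y =
  @idop R _ x y + c * gen P x y + c ^+ 2 * tens2 P x y.
Proof.
case: x y => [x1 x2] [y1 y2].
by rewrite /tens2 /gen /idop /= xpair_eqE -mulnb natrM; ring.
Qed.

Lemma opmul_lin3 (A B D Y : op R Q2) c e x z :
  opmul (fun x y => A x y + c * B x y + e * D x y) Y x z =
  opmul A Y x z + c * opmul B Y x z + e * opmul D Y x z.
Proof.
by rewrite /opmul !mulr_sumr -!big_split; apply: eq_bigr => y _ /=; ring.
Qed.

Lemma opmul_lin3r (A B D Y : op R Q2) c e x z :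
  opmul Y (fun x y => A x y + c * B x y + e * D x y) x z =
  opmul Y A x z + c * opmul Y B x z + e * opmul Y D x z.
Proof.
by rewrite /opmul !mulr_sumr -!big_split; apply: eq_bigr => y _ /=; ring.
Qed.

(* 1 + cP is unitary for c = -2 and c = i - 1; eliminating P (x) P between the two
   commutation relations leaves the infinitesimal one. *)
Lemma commutant_projector Y (P : Mt R N) : commutant S Y -> acts_within S P ->
  adj P = P -> opmul P P = P -> opmul (gen P) Y = opmul Y (gen P).
Proof.
move=> YW Ploc Padj PP.
pose V c : Mt R N := fun x y => 1 * @idop R _ x y + c * P x y.
have Vunit c : conjc c + c + conjc c * c = 0 -> local_unitaries S (V c).
  move=> c0; split; last exact: acts_within_lin acts_within_idop Ploc.
  have Pc x y : conjc (P x y) = P y x by rewrite -[in RHS]Padj.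
  have PPe x y : \sum_z P x z * P z y = P x y by rewrite -[RHS](congr1 (fun f => f x y) PP).
  have expand e f x y : \sum_z ((x == z)%:R + e * P x z) * ((z == y)%:R + f * P z y)
      = (x == y)%:R + (e + f + e * f) * P x y.
    transitivity (\sum_z ((x == z)%:R * ((z == y)%:R + f * P z y) +
       e * P x z * (z == y)%:R + e * f * (P x z * P z y))).
      by apply: eq_bigr => z _; ring.
    rewrite !big_split /= sum_delta -mulr_sumr PPe.
    by rewrite (sum_delta_r y (fun z => e * P x z)); ring.
  move=> x y; split.
    transitivity (\sum_z ((x == z)%:R + conjc c * P x z) * ((z == y)%:R + c * P z y)).
      apply: eq_bigr => z _; rewrite /adj /V /idop !mul1r rmorphD /= conjcM Pc conjc_nat.
      by rewrite (eq_sym z x).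
    by rewrite expand c0 mul0r addr0.
  transitivity (\sum_z ((x == z)%:R + c * P x z) * ((z == y)%:R + conjc c * P z y)).
    apply: eq_bigr => z _; rewrite /adj /V /idop !mul1r rmorphD /= conjcM Pc conjc_nat.
    by rewrite (eq_sym y z).
  by rewrite expand [c + _]addrC [c * _]mulrC c0 mul0r addr0.
have rel c x z : conjc c + c + conjc c * c = 0 ->
   c * (opmul (gen P) Y x z - opmul Y (gen P) x z) +
   c ^+ 2 * (opmul (tens2 P) Y x z - opmul Y (tens2 P) x z) = 0.
  move=> /Vunit /YW /(congr1 (fun f => f x z)).
  have -> : tens2 (V c) = (fun x y => @idop R _ x y + c * gen P x y + c ^+ 2 * tens2 P x y).
    by apply/funext => u; apply/funext => v; exact: tens2_shift.
  rewrite opmul_lin3 opmul_lin3r opmul1l opmul1r => /eqP.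
  by rewrite -subr_eq0 => /eqP e; rewrite -[RHS]e; ring.
apply/funext => x; apply/funext => z; apply/eqP; rewrite -subr_eq0; apply/eqP.
have i2 : 'i%C * 'i%C = -1 :> C by rewrite -expr2 sqr_i.
have ci : conjc ('i%C - 1) = - 'i%C - 1 :> C.
  by apply/eqP; rewrite eq_complex /= !(subr0, oppr0, addr0, sub0r) !eqxx.
have c2 : conjc (-2) = -2 :> C by rewrite rmorphN; congr (- _); exact: conjc_nat.
move: (rel ('i%C - 1) x z) (rel (-2) x z); rewrite ci c2.
set g := opmul (gen P) Y x z - _; set h := opmul (tens2 P) Y x z - _ => h1 h2.
have {}h1 : ('i%C - 1) * g + ('i%C - 1) ^+ 2 * h = 0 by apply: h1; ring: i2.
have {}h2 : -2 * g + (-2) ^+ 2 * h = 0 by apply: h2; ring.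
have iN1 : ('i%C - 1) != 0 :> C by rewrite eq_complex /= subr0 sub0r oppr_eq0 oner_eq0.
have g2 : g = 2 * h.
  apply: (@mulfI _ (-2)); first by rewrite oppr_eq0 pnatr_eq0.
  by apply/eqP; rewrite -subr_eq0 -[X in _ == X]h2; apply/eqP; ring.
have : (1 + 'i%C) * h = 0.
  apply: (mulfI iN1); rewrite mulr0 -[RHS]h1 g2; ring: i2.
move/eqP; rewrite mulf_eq0 => /orP[|/eqP h0]; last by rewrite g2 h0 mulr0.
by rewrite eq_complex /= addr0 oner_eq0.
Qed.

End Commutant.

Section CommutantForm.
Variables (R : realType) (N : nat) (S : {set 'I_N}).
Local Notation C := R[i].
Local Notation Q2 := (qb N * qb N)%type.
Local Notation elop := (@elem_op R N S).

(** For |w| = 1 this is the projector onto the span of e_a + conj(w) e_b. Since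
    [commutant_projector] only handles orthogonal projectors, off-diagonal matrix units are reached
    through these. *)
Definition mixop (w : C) (a b : lab S) : Mt R N := fun x y =>
  2^-1 * (1 * elop a a x y + 1 * elop b b x y) +
  2^-1 * (w * elop a b x y + conjc w * elop b a x y).

Lemma mixop_adj w a b : adj (mixop w a b) = mixop w a b.
Proof.
apply/funext => x; apply/funext => y; rewrite /adj /mixop.
have ea c d : conjc (elop c d y x) = elop d c x y by rewrite -[LHS]/(adj (elop c d) x y) elop_adj.
have c2 : conjc (2^-1) = 2^-1 :> C by rewrite conjc_inv; congr (_^-1); exact: conjc_nat.
have lin (h w1 w2 e1 e2 e3 e4 : C) :
    conjc (h * (1 * e1 + 1 * e2) + h * (w1 * e3 + w2 * e4)) =
    conjc h * (conjc e1 + conjc e2) + conjc h * (conjc w1 * conjc e3 + conjc w2 * conjc e4).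
  by rewrite !(conjcD, conjcM) conjc1 !mul1r.
by rewrite lin c2 conjcK !ea; ring.
Qed.

Lemma mixop_idem w a b : a != b -> w * conjc w = 1 ->
  opmul (mixop w a b) (mixop w a b) = mixop w a b.
Proof.
move=> ab ww; apply/funext => x; apply/funext => y.
pose e c d c' d' := opmul (elop c d) (elop c' d') x y.
transitivity (4^-1 * (e a a a a + e a a b b + w * e a a a b + conjc w * e a a b a
  + e b b a a + e b b b b + w * e b b a b + conjc w * e b b b a
  + w * (e a b a a + e a b b b + w * e a b a b + conjc w * e a b b a)
  + conjc w * (e b a a a + e b a b b + w * e b a a b + conjc w * e b a b a))).
  rewrite /e /opmul !mulr_sumr -!big_split /= !mulr_sumr -!big_split /= mulr_sumr.
  by apply: eq_bigr => z _; rewrite /mixop; field.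
rewrite /e !elop_mul !eqxx (eq_sym b a) (negbTE ab) /mixop /=.
by field: ww.
Qed.

Lemma mixop_local w a b : acts_within S (mixop w a b).
Proof.
apply: (@acts_within_lin _ _ S (fun x y => 1 * elop a a x y + 1 * elop b b x y)
  (fun x y => w * elop a b x y + conjc w * elop b a x y));
by apply: acts_within_lin; exact: elop_local.
Qed.

Lemma gen_lin (P P' : Mt R N) c c' x y :
  gen (fun x y => c * P x y + c' * P' x y) x y = c * gen P x y + c' * gen P' x y.
Proof. by rewrite /gen; ring. Qed.

Definition gcomm Y (P : Mt R N) (x y : Q2) : C := opmul (gen P) Y x y - opmul Y (gen P) x y.

Lemma gcomm_lin Y (P P' : Mt R N) c c' x y :
  gcomm Y (fun x y => c * P x y + c' * P' x y) x y = c * gcomm Y P x y + c' * gcomm Y P' x y.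
Proof.
rewrite /gcomm /opmul !mulrBr !mulr_sumr addrACA -opprD -!big_split /=.
by congr (_ - _); apply: eq_bigr => z _; rewrite gen_lin; ring.
Qed.

Lemma commutant_elop Y a b : commutant S Y -> opmul (gen (elop a b)) Y = opmul Y (gen (elop a b)).
Proof.
move=> YW.
have diag c : opmul (gen (elop c c)) Y = opmul Y (gen (elop c c)).
  apply: commutant_projector YW _ _ _; [exact: elop_local|exact: elop_adj|].
  by apply/funext => x; apply/funext => y; rewrite elop_mul eqxx mul1r.
have [<-//|ab] := eqVneq a b.
apply/funext => x; apply/funext => y; apply/eqP; rewrite -subr_eq0; apply/eqP.
have diag0 c : gcomm Y (elop c c) x y = 0 by rewrite /gcomm diag subrr.
have mix w : w * conjc w = 1 -> w * gcomm Y (elop a b) x y + conjc w * gcomm Y (elop b a) x y = 0.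
  move=> ww; have := commutant_projector YW (mixop_local w a b) (mixop_adj w a b) (mixop_idem ab ww).
  move=> /(congr1 (fun f => f x y)) /eqP; rewrite -subr_eq0 -/(gcomm Y _ x y).
  rewrite (gcomm_lin Y (fun x y => 1 * elop a a x y + 1 * elop b b x y)
  (fun x y => w * elop a b x y + conjc w * elop b a x y)) !gcomm_lin !diag0 !mulr0 addr0 mulr0 add0r.
  by rewrite mulf_eq0 invr_eq0 pnatr_eq0 /= => /eqP.
have i2 : 'i%C * 'i%C = -1 :> C by rewrite -expr2 sqr_i.
have ci : conjc ('i%C) = - 'i%C :> C.
  by apply/eqP; rewrite eq_complex /= !oppr0 !eqxx.
(* w = 1 gives the sum of the two matrix units and w = i their difference up to the factor i;
   together they isolate [elop a b]. *)
have := mix 1; rewrite conjc1 mulr1 => /(_ erefl) h1.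
have := mix 'i%C; rewrite ci mulrN i2 opprK => /(_ erefl) h2.
rewrite -/(gcomm Y _ x y); apply: (@mulfI _ 2); first by rewrite pnatr_eq0.
transitivity (1 * gcomm Y (elop a b) x y + 1 * gcomm Y (elop b a) x y -
  'i%C * ('i%C * gcomm Y (elop a b) x y + - 'i%C * gcomm Y (elop b a) x y)); first by ring: i2.
by rewrite h1 h2 !mulr0 subrr.
Qed.

Lemma opmul_gen_elop Y a b x z : opmul (gen (elop a b)) Y x z =
  (res S x.1 == a)%:R * Y (mrg b x.1, x.2) z + (res S x.2 == a)%:R * Y (x.1, mrg b x.2) z.
Proof.
rewrite /opmul sum_pair /gen /=.
under eq_bigr => u _ do [under eq_bigr => v _ do rewrite mulrDl; rewrite big_split /=].
rewrite big_split /=; congr (_ + _).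
  transitivity (\sum_u (\sum_v (x.2 == v)%:R * Y (u, v) z) * (res S x.1 == a)%:R * (u == mrg b x.1)%:R).
    apply: eq_bigr => u _; rewrite -mulrA mulr_suml; apply: eq_bigr => v _.
    by rewrite /elem_op; ring.
  by rewrite sum_delta_r sum_delta mulrC.
transitivity (\sum_u (x.1 == u)%:R * \sum_v Y (u, v) z * (res S x.2 == a)%:R * (v == mrg b x.2)%:R).
  apply: eq_bigr => u _; rewrite mulr_sumr; apply: eq_bigr => v _.
  by rewrite /elem_op; ring.
by rewrite sum_delta sum_delta_r mulrC.
Qed.

Lemma opmul_elop_gen Y a b x z : opmul Y (gen (elop a b)) x z =
  (res S z.1 == b)%:R * Y x (mrg a z.1, z.2) + (res S z.2 == b)%:R * Y x (z.1, mrg a z.2).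
Proof.
rewrite /opmul sum_pair /gen /=.
under eq_bigr => u _ do [under eq_bigr => v _ do rewrite mulrDr; rewrite big_split /=].
rewrite big_split /=; congr (_ + _).
  transitivity (\sum_u (\sum_v Y x (u, v) * (v == z.2)%:R) * (res S z.1 == b)%:R * (u == mrg a z.1)%:R).
    apply: eq_bigr => u _; rewrite -mulrA mulr_suml; apply: eq_bigr => v _.
    by rewrite elopE'; ring.
  by rewrite sum_delta_r sum_delta_r mulrC.
transitivity (\sum_u (\sum_v Y x (u, v) * (res S z.2 == b)%:R * (v == mrg a z.2)%:R) * (u == z.1)%:R).
  apply: eq_bigr => u _; rewrite mulr_suml; apply: eq_bigr => v _.
  by rewrite elopE'; ring.
by rewrite !sum_delta_r mulrC.
Qed.

Definition off_support (A : op R Q2) := forall x y x' y' : Q2,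
  (forall i, i \notin S -> x.1 i = x'.1 i /\ x.2 i = x'.2 i) ->
  (forall i, i \notin S -> y.1 i = y'.1 i /\ y.2 i = y'.2 i) -> A x y = A x' y'.

(** [invariant_tensor] applied with the coordinates off [S] frozen: [Y] is A (x) 1 + B (x) swap,
    where [A] and [B] act off [S]. *)
Lemma commutant_form Y : S != finset.set0 -> commutant S Y -> exists A B,
  [/\ off_support A, off_support B & forall x y, Y x y =
    ((res S x.1 == res S y.1) && (res S x.2 == res S y.2))%:R * A x y +
    ((res S x.1 == res S y.2) && (res S x.2 == res S y.1))%:R * B x y].
Proof.
move=> /set0Pn[i0 i0S] YW.
(* The reference labels are the constant ones; they differ because [S] is nonempty. *)
pose p : lab S := [ffun=> false]; pose q : lab S := [ffun=> true].
have pq : p != q.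
  apply/eqP => /ffunP /(_ (exist (fun i => i \in S) i0 i0S)); by rewrite !ffunE.
exists (fun x y => Y (mrg p x.1, mrg q x.2) (mrg p y.1, mrg q y.2)).
exists (fun x y => Y (mrg p x.1, mrg q x.2) (mrg q y.1, mrg p y.2)).
split.
- by move=> x y x' y' hx hy; congr (Y (_, _) (_, _)); apply: mrg_agree => i iS;
    have [] := hx i iS; have [] := hy i iS.
- by move=> x y x' y' hx hy; congr (Y (_, _) (_, _)); apply: mrg_agree => i iS;
    have [] := hx i iS; have [] := hy i iS.
move=> x y.
pose z (a b c d : lab S) := Y (mrg a x.1, mrg b x.2) (mrg c y.1, mrg d y.2).
have <- : z (res S x.1) (res S x.2) (res S y.1) (res S y.2) = Y x y.
  by rewrite /z !mrg_res -!surjective_pairing.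
have C2 : 2 != 0 :> C by rewrite pnatr_eq0.
apply: (@invariant_tensor _ _ z C2 _ p q) => // i j a b c d.
have /(congr1 (fun f => f (mrg a x.1, mrg b x.2) (mrg c y.1, mrg d y.2))) := commutant_elop i j YW.
by rewrite opmul_gen_elop opmul_elop_gen /= !res_mrg !mrg_mrg.
Qed.

End CommutantForm.

(** * Twirling swaps *)

Section Twirl.
Variables (R : realType) (N : nat) (S : {set 'I_N}).
Local Notation C := R[i].
Local Notation Q2 := (qb N * qb N)%type.
Implicit Types X Y Z : op R Q2.

Lemma commutant_lin Y Z (c c' : C) : commutant S Y -> commutant S Z ->
  commutant S (fun x y => c * Y x y + c' * Z x y).
Proof.
move=> YW ZW V LV; apply/funext => x; apply/funext => y.
transitivity (c * opmul (tens2 V) Y x y + c' * opmul (tens2 V) Z x y).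
  by rewrite /opmul !mulr_sumr -big_split; apply: eq_bigr => z _ /=; ring.
rewrite YW // ZW // /opmul !mulr_sumr -big_split; apply: eq_bigr => z _ /=; ring.
Qed.

Lemma commutant_adj Y : commutant S Y -> commutant S (adj Y).
Proof.
move=> YW V LV; have := YW _ (local_unitaries_adj LV).
by rewrite tens2_adj => /(congr1 (@adj _ _)); rewrite !adj_opmul adjK => ->.
Qed.

(** The difference of the two candidates lies in the commutant and is orthogonal to it; as the
    commutant is closed under adjoints, the difference may be paired with its own adjoint. *)
Lemma twirl_unique Phi X Y : is_twirl S Phi -> commutant S Y ->
  (forall Z, commutant S Z -> pairing X Z = pairing Y Z) -> Phi X = Y.
Proof.
move=> [PW Pp] YW XY.
pose D : op R Q2 := fun x y => 1 * Phi X x y + (-1) * Y x y.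
have DW : commutant S D by apply: commutant_lin.
have /pairing_adj_eq0 D0 : pairing D (adj D) = 0.
  rewrite pairingDl !pairingZl Pp; last exact: commutant_adj.
  by rewrite XY ?mul1r ?mulN1r ?subrr //; exact: commutant_adj.
apply/funext => x; apply/funext => y; have := congr1 (fun f => f x y) D0.
by rewrite /D mul1r mulN1r => /subr0_eq.
Qed.

Lemma twirl_id Phi X : is_twirl S Phi -> commutant S X -> Phi X = X.
Proof. by move=> PT XW; apply: twirl_unique. Qed.

Lemma twirl_lin Phi X Y (c c' : C) : is_twirl S Phi ->
  Phi (fun x y => c * X x y + c' * Y x y) = fun x y => c * Phi X x y + c' * Phi Y x y.
Proof.
move=> PT; have [PW Pp] := PT; apply: twirl_unique => //; first exact: commutant_lin.
by move=> Z ZW; rewrite !pairingDl !pairingZl !Pp.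
Qed.

Lemma twirl_sym Phi X Y : is_twirl S Phi -> pairing (Phi X) Y = pairing X (Phi Y).
Proof.
move=> [PW Pp]; transitivity (pairing (Phi Y) (Phi X)).
  by rewrite [RHS]Pp // pairingC.
by rewrite pairingC [LHS]Pp.
Qed.

End Twirl.

Section Swap.
Variables (R : realType) (N : nat).
Local Notation C := R[i].
Local Notation Q2 := (qb N * qb N)%type.
Implicit Types (S T U : {set 'I_N}) (x y : Q2).

Definition swp T x : Q2 :=
  ([ffun i => if i \in T then x.2 i else x.1 i],
   [ffun i => if i \in T then x.1 i else x.2 i]).

Definition swapop T : op R Q2 := fun x y => (x == swp T y)%:R.

Lemma eq_qb2 (x y : Q2) : (forall i, x.1 i = y.1 i /\ x.2 i = y.2 i) -> x = y.
Proof.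
case: x y => [x1 x2] [y1 y2] /= h; congr (_, _); apply/ffunP => i; by case: (h i).
Qed.

Lemma swp_swp S T x : swp S (swp T x) = swp ((S :\: T) :|: (T :\: S)) x.
Proof. by apply: eq_qb2 => i; rewrite /= !ffunE !inE; case: (i \in S); case: (i \in T). Qed.

Lemma swpK T : involutive (swp T).
Proof. by move=> x; apply: eq_qb2 => i; rewrite /= !ffunE; case: (i \in T). Qed.

Lemma swp_eqC T x y : (x == swp T y) = (y == swp T x).
Proof. by rewrite -(inj_eq (can_inj (swpK T))) swpK eq_sym. Qed.

Lemma opmul_swap_r T Y x y : opmul Y (swapop T) x y = Y x (swp T y).
Proof. by rewrite /opmul sum_delta_r. Qed.

Lemma opmul_swap_l T Y x y : opmul (swapop T) Y x y = Y (swp T x) y.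
Proof.
rewrite /opmul -[RHS](sum_delta (swp T x) (fun z => Y z y)); apply: eq_bigr => z _.
by rewrite /swapop swp_eqC eq_sym.
Qed.

Lemma pairing_swap T Z : pairing (swapop T) Z = \sum_x Z x (swp T x).
Proof. by rewrite pairingC pairingE; apply: eq_bigr => x _; rewrite opmul_swap_r. Qed.

Lemma commutant_swap S T : (S \subset T) || [disjoint S & T] -> commutant S (swapop T).
Proof.
move=> ST V [_ [W [Wd VW]]]; apply/funext => x; apply/funext => y.
rewrite opmul_swap_r opmul_swap_l /tens2 !VW [LHS]mulrACA [RHS]mulrACA.
rewrite -!natrM !mulnb; congr ((nat_of_bool _)%:R * _).
  apply/andP/andP => -[/forallP h1 /forallP h2]; split; apply/forallP => i;
    apply/implyP => iS; have /implyP/(_ iS) := h1 i; have /implyP/(_ iS) := h2 i;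
    by rewrite !ffunE; case: ifP.
have agree (u v : qb N) : (forall i, i \in S -> u i = v i) -> [forall i in S, u i == v i].
  by move=> h; apply/forallP => i; apply/implyP => iS; apply/eqP/h.
case/orP: ST => [/fintype.subsetP ST|ST].
  rewrite (Wd x.1 (swp T y).1 x.1 y.2) ?(Wd x.2 (swp T y).2 x.2 y.1) ?(Wd (swp T x).1 y.1 x.2 y.1)
    ?(Wd (swp T x).2 y.2 x.1 y.2) 1?mulrC //; apply: agree => i iS //; by rewrite ffunE (ST i iS).
rewrite (Wd x.1 (swp T y).1 x.1 y.1) ?(Wd x.2 (swp T y).2 x.2 y.2) ?(Wd (swp T x).1 y.1 x.1 y.1)
  ?(Wd (swp T x).2 y.2 x.2 y.2) //; apply: agree => i iS //; by rewrite ffunE (disjointFr ST iS).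
Qed.

Lemma card_lab U : #|{: lab U}| = (2 ^ #|U|)%N.
Proof. by rewrite card_ffun card_bool card_sig. Qed.

(** Two copies agree on [U] for one of 2^|U| equally weighted difference patterns: flipping the
    first copy on [U] by a pattern permutes them without changing [g]. *)
Lemma sum_agree U (g : Q2 -> C) :
  (forall x x', (forall i, i \notin U -> x.1 i = x'.1 i /\ x.2 i = x'.2 i) -> g x = g x') ->
  \sum_x (res U x.1 == res U x.2)%:R * g x = ((2^-1) ^+ #|U|)%:C%C * \sum_x g x.
Proof.
move=> gU.
pose xl x : lab U := [ffun i => x.1 (val i) (+) x.2 (val i)].
pose fl (c : lab U) x : Q2 := (mrg [ffun i => x.1 (val i) (+) c i] x.1, x.2).
have flK c : involutive (fl c).
  move=> x; apply: eq_qb2 => i; split => //=.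
  have [iU|iU] := boolP (i \in U); last by rewrite !mrg_notin.
  by rewrite -[ i ]/(val (exist (fun i => i \in U) i iU)) mrg_in ffunE -/(val _) mrg_in ffunE addbK.
have step c : \sum_x (xl x == c)%:R * g x = \sum_x (res U x.1 == res U x.2)%:R * g x.
  rewrite (reindex_inj (can_inj (flK c))); apply: eq_bigr => x _; congr ((nat_of_bool _)%:R * _).
    apply/eqP/eqP => [/ffunP h|/ffunP h]; apply/ffunP => i; move: (h i).
      rewrite ffunE /= mrg_in !ffunE; case: (x.1 _); case: (x.2 _); by case: (c i).
    rewrite 2!ffunE => e; rewrite ffunE /= mrg_in ffunE e; by case: (x.2 _); case: (c i).
  by apply: gU => i iU /=; rewrite mrg_notin.
have : \sum_x g x = \sum_(c : lab U) \sum_x (xl x == c)%:R * g x.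
  rewrite exchange_big; apply: eq_bigr => x _; rewrite -mulr_suml.
  by under eq_bigr => c _ do rewrite -[_%:R]mulr1; rewrite sum_delta mul1r.
move=> ->; under [in RHS]eq_bigr => c _ do rewrite step.
rewrite sumr_const -[X in _ = _ * X]mulr_natl card_lab mulrA natrX rmorphXn /= fmorphV rmorph_nat.
by rewrite -exprMn mulVf ?expr1n ?mul1r // pnatr_eq0.
Qed.

(** Against the identity part of [Z], the swap forces the copies to agree on [T :&: S]; against the
    swap part, where [S] is swapped once more, it forces agreement on [S :\: T]. Each costs a factor
    given by [sum_agree]. *)
Lemma pairing_swap_form S T (A B Z : op R Q2) :
  off_support S A -> off_support S B -> (forall x y, Z x y =
    ((res S x.1 == res S y.1) && (res S x.2 == res S y.2))%:R * A x y +
    ((res S x.1 == res S y.2) && (res S x.2 == res S y.1))%:R * B x y) ->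
  pairing (swapop T) Z =
    ((2^-1) ^+ #|T :&: S|)%:C%C * (\sum_x A x (swp (T :\: S) x)) +
    ((2^-1) ^+ #|S :\: T|)%:C%C * (\sum_x B x (swp (T :\: S) x)).
Proof.
move=> As Bs ZE; rewrite pairing_swap.
have offS (D : op R Q2) U x x' : off_support S D -> U \subset S ->
    (forall i, i \notin U -> x.1 i = x'.1 i /\ x.2 i = x'.2 i) ->
    D x (swp (T :\: S) x) = D x' (swp (T :\: S) x').
  move=> Ds /fintype.subsetP US h; apply: Ds => i iS; have /h [h1 h2] : i \notin U.
  - by apply: contra iS; apply: US.
  - by [].
  - by apply: contra iS; apply: US.
  - by rewrite /= !ffunE h1 h2.
rewrite -(@sum_agree (T :&: S) (fun x => A x (swp (T :\: S) x))); last first.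
  by move=> x x' /(offS A _ x x' As); apply; exact: subsetIr.
rewrite -(@sum_agree (S :\: T) (fun x => B x (swp (T :\: S) x))); last first.
  by move=> x x' /(offS B _ x x' Bs); apply; exact: subsetDl.
rewrite -big_split; apply: eq_bigr => x _; rewrite ZE /=.
have offT (D : op R Q2) : off_support S D -> D x (swp T x) = D x (swp (T :\: S) x).
  by move=> Ds; apply: Ds => // i iS; rewrite !ffunE !inE iS.
rewrite -!offT //; congr ((nat_of_bool _)%:R * _ + (nat_of_bool _)%:R * _).
  apply/andP/res_eqP => [[/res_eqP h _] i|h].
    by rewrite inE => /andP[iT iS]; have := h i iS; rewrite ffunE iT.
  split; apply/res_eqP => i iS; rewrite ffunE; case: ifP => // iT;
    by rewrite (h i) // inE iT iS.
apply/andP/res_eqP => [[/res_eqP h _] i|h].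
  by rewrite inE => /andP[iT iS]; have := h i iS; rewrite ffunE (negbTE iT).
split; apply/res_eqP => i iS; rewrite ffunE; case: ifP => // iT;
  by rewrite (h i) // inE iT iS.
Qed.

Lemma twirl_swap Phi S T (t r : R) : is_twirl S Phi -> S != finset.set0 ->
  t = (2^-1) ^+ #|T :&: S| -> r = (2^-1) ^+ #|S :\: T| ->
  Phi (swapop T) = fun x y =>
    (t * (1 - r ^+ 2) / (1 - (t * r) ^+ 2))%:C%C * swapop (T :\: S) x y +
    (r * (1 - t ^+ 2) / (1 - (t * r) ^+ 2))%:C%C * swapop (T :|: S) x y.
Proof.
move=> PT S0 tE rE.
have trE : t * r = (2^-1) ^+ #|S|.
  by rewrite tE rE -exprD finset.setIC cardsID.
have tr1 : 1 - (t * r) ^+ 2 != 0.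
  rewrite trE -exprM subr_eq0 eq_sym lt_eqF // exprn_ilt1 ?invr_ge0 ?invf_lt1 ?ltr1n //.
  by rewrite muln_eq0 cards_eq0 negb_or S0.
set al := _ / _; set be := r * _ / _.
(* The two weights solve the linear system that matches the pairings with the [A] and the [B] part
   of a general commutant element. Its determinant 1 - (t r)^2 is nonzero because [S] is
   nonempty. *)
have e1 : al + be * (t * r) = t by rewrite /al /be; field.
have e2 : al * (t * r) + be = r by rewrite /al /be; field.
apply: twirl_unique PT _ _.
  apply: commutant_lin; apply: commutant_swap; apply/orP.
    by right; rewrite -setI_eq0; apply/eqP/setP => i; rewrite !inE; case: (i \in S).
  by left; exact: finset.subsetUr.
move=> Z ZW; have [A [B [As Bs ZE]]] := commutant_form S0 ZW.
rewrite pairingDl !pairingZl !(pairing_swap_form _ As Bs ZE).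
have -> : (T :\: S) :\: S = T :\: S.
  by apply/setP => i; rewrite !inE; case: (i \in S); case: (i \in T).
have -> : (T :|: S) :\: S = T :\: S.
  by apply/setP => i; rewrite !inE; case: (i \in S); case: (i \in T).
have -> : (T :\: S) :&: S = finset.set0.
  by apply/setP => i; rewrite !inE; case: (i \in S); case: (i \in T).
have -> : S :\: (T :\: S) = S.
  by apply/setP => i; rewrite !inE; case: (i \in S); case: (i \in T).
have -> : (T :|: S) :&: S = S.
  by apply/setP => i; rewrite !inE; case: (i \in S); case: (i \in T).
have -> : S :\: (T :|: S) = finset.set0.
  by apply/setP => i; rewrite !inE; case: (i \in S); case: (i \in T).
rewrite cards0 expr0 -trE -tE -rE rmorph1; set a := \sum_x A _ _; set b := \sum_x B _ _.
transitivity ((al + be * (t * r))%:C%C * a + (al * (t * r) + be)%:C%C * b).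
  by rewrite e1 e2.
by rewrite !(rmorphD, rmorphM) /=; ring.
Qed.

End Swap.

(** * The span of the four swaps *)

Section Factorization.
Variables (R : realType) (N : nat) (S : {set 'I_N}).
Local Notation C := R[i].
Local Notation Q2 := (qb N * qb N)%type.

(** Coordinates on [S] and off [S] are independent under the uniform measure; exchanging the
    coordinates off [S] between two samples is an involution that separates [f] from [g]. *)
Lemma sum_prod_independent (f g : Q2 -> C) :
  (forall x x' : Q2, (forall i, i \in S -> x.1 i = x'.1 i /\ x.2 i = x'.2 i) -> f x = f x') ->
  (forall x x' : Q2, (forall i, i \notin S -> x.1 i = x'.1 i /\ x.2 i = x'.2 i) -> g x = g x') ->
  \sum_x f x * g x = (#|{: Q2}|%:R)^-1 * ((\sum_x f x) * (\sum_x g x)).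
Proof.
move=> fS gS.
pose mix (x y : Q2) : Q2 := (mrg (res S x.1) y.1, mrg (res S x.2) y.2).
have mix_in x y i : i \in S -> (mix x y).1 i = x.1 i /\ (mix x y).2 i = x.2 i.
  by move=> iS; rewrite /= -[ i ]/(val (exist (fun i => i \in S) i iS)) !mrg_in !ffunE.
have mix_out x y i : i \notin S -> (mix x y).1 i = y.1 i /\ (mix x y).2 i = y.2 i.
  by move=> iS; rewrite /= !mrg_notin.
pose h (p : Q2 * Q2) := (mix p.1 p.2, mix p.2 p.1).
have hK : involutive h.
  have mixK x y : mix (mix x y) (mix y x) = x.
    apply: eq_qb2 => i; have [iS|iS] := boolP (i \in S).
      have [e1 e2] := mix_in (mix x y) (mix y x) i iS; have [f1 f2] := mix_in x y i iS.
      by rewrite e1 e2 f1 f2.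
    have [e1 e2] := mix_out (mix x y) (mix y x) i iS; have [f1 f2] := mix_out y x i iS.
    by rewrite e1 e2 f1 f2.
  by move=> [x y]; rewrite /h -[(_, _).1]/(mix x y) -[(_, _).2]/(mix y x) !mixK.
have card0 : #|{: Q2}|%:R != 0 :> C.
  rewrite pnatr_eq0 -lt0n; apply/card_gt0P; by exists ([ffun=> false], [ffun=> false]).
apply: (mulfI card0); rewrite mulrA mulfV // mul1r.
transitivity (\sum_(p : Q2 * Q2) f p.1 * g p.1).
  rewrite [RHS]sum_pair mulr_sumr; apply: eq_bigr => x _.
  by rewrite /= sumr_const -[RHS]mulr_natl.
rewrite (reindex_inj (can_inj hK)) [LHS]sum_pair mulr_suml; apply: eq_bigr => x _.
rewrite mulr_sumr; apply: eq_bigr => y _ /=; congr (_ * _).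
  by apply: fS => i /(mix_in x y).
by apply: gS => i /(mix_out x y).
Qed.

End Factorization.

Section Layout.
Variables (R : realType) (N : nat).
Hypothesis N5 : (5 <= N)%N.
Local Notation C := R[i].
Local Notation Q2 := (qb N * qb N)%type.
Local Notation F := (@swapop R N).
Local Notation S1 := (S_23N N).
Local Notation S2 := (S_12 N).
Local Notation S3 := (S_134N N).
Local Notation O := (~: S_23N N).
Local Notation full := [set: 'I_N]%SET.
Implicit Types (X Y Z : op R Q2) (Phi Psi : chan R Q2).

(** The factors 1 present it as nested combinations of two operators, the shape in which
    [pairingZl], [twirl_lin] and [lin_chan] apply. *)
Definition swap4 (c0 c1 c2 c3 : C) : op R Q2 := fun x y =>
  1 * (c0 * F finset.set0 x y + c1 * F O x y) + 1 * (c2 * F S1 x y + c3 * F full x y).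

Definition in_swap4 Y := exists c0 c1 c2 c3, Y = swap4 c0 c1 c2 c3.

Lemma cardO : #|O| = 1%N.
Proof.
have N0 : (0 < N)%N by apply: leq_trans N5.
rewrite (_ : O = [set Ordinal N0]%SET) ?cards1 //; apply/setP => i.
by rewrite !inE -ltnNge ltnS leqn0.
Qed.

Lemma res_swp_disjoint (U V : {set 'I_N}) (x : Q2) : [disjoint V & U]%B ->
  res V (swp U x).1 = res V x.1 /\ res V (swp U x).2 = res V x.2.
Proof.
by move=> VU; split; apply/eqP/res_eqP => i iV; rewrite ffunE (disjointFr VU iV).
Qed.

Lemma res_swp_sub (U V : {set 'I_N}) (x : Q2) : V \subset U ->
  res V (swp U x).1 = res V x.2 /\ res V (swp U x).2 = res V x.1.
Proof.
by move=> /fintype.subsetP VU; split; apply/eqP/res_eqP => i /VU iU; rewrite ffunE iU.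
Qed.

Lemma eq_res_split (V : {set 'I_N}) (x y : Q2) : (x == y) =
  (res (~: V) x.1 == res (~: V) y.1) && (res (~: V) x.2 == res (~: V) y.2) &&
  ((res V y.1 == res V x.1) && (res V y.2 == res V x.2)).
Proof.
apply/eqP/idP => [->|]; first by rewrite !eqxx.
move=> /andP[/andP[/res_eqP h1 /res_eqP h2] /andP[/res_eqP h3 /res_eqP h4]].
apply: eq_qb2 => i; have [iV|iV] := boolP (i \in V); first by rewrite h3 ?h4.
by rewrite h1 ?h2 // inE.
Qed.

(** By [commutant_form], [Y] is free only on the two copies of qubit 1. Test operators that commute
    with unitaries on that qubit see only its twirl there, which leaves the four swaps. *)
Lemma commutant_S1_reduce Y : commutant S1 Y ->
  exists2 v, in_swap4 v & forall Z, commutant O Z -> pairing Y Z = pairing v Z.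
Proof.
move=> YW.
have S10 : S1 != finset.set0.
  have N1 : (1 < N)%N by apply: leq_trans N5.
  by apply/set0Pn; exists (Ordinal N1); rewrite inE.
have O0 : O != finset.set0 by rewrite -card_gt0 cardO.
have [A [B [As Bs YE]]] := commutant_form S10 YW.
pose M : C := #|{: Q2}|%:R.
have M0 : M != 0.
  rewrite pnatr_eq0 -lt0n; apply/card_gt0P; by exists ([ffun=> false], [ffun=> false]).
pose a0 := \sum_x A x x; pose a1 := \sum_x A (swp O x) x.
pose b0 := \sum_x B (swp S1 x) x; pose b1 := \sum_x B (swp full x) x.
(* These invert the normalised Gram matrix of identity and swap on one qubit, with diagonal 1,
   off-diagonal 1/2 and determinant 3/4. *)
exists (swap4 ((4 * a0 - 2 * a1) / (3 * M)) ((4 * a1 - 2 * a0) / (3 * M))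
  ((4 * b0 - 2 * b1) / (3 * M)) ((4 * b1 - 2 * b0) / (3 * M))).
  by do 4!eexists.
move=> Z ZW; have [D [E [Ds Es ZE]]] := commutant_form O0 ZW.
rewrite pairingDl !pairingZl !pairingDl !pairingZl !(pairing_swap_form _ Ds Es ZE).
rewrite !finset.set0I !finset.setD0 finset.setIid finset.setDv finset.setICr.
rewrite (_ : finset.set0 :\: O = finset.set0); last by apply/setP => i; rewrite !inE andbF.
rewrite (_ : S1 :\: O = S1); last by apply/setP => i; rewrite !inE negbK; case: (_ <= _)%N.
rewrite (_ : O :\: S1 = O); last by apply/setP => i; rewrite !inE; case: (_ <= _)%N.
rewrite (_ : full :&: O = O); last by apply/setP => i; rewrite !inE.
rewrite (_ : full :\: O = S1); last by apply/setP => i; rewrite !inE negbK andbT.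
rewrite (_ : O :\: full = finset.set0); last by apply/setP => i; rewrite !inE.
rewrite cards0 cardO expr0 expr1 rmorph1 fmorphV rmorph_nat.
set m0 := \sum_x D x (swp finset.set0 x); set n0 := \sum_x E x (swp finset.set0 x).
set m1 := \sum_x D x (swp S1 x); set n1 := \sum_x E x (swp S1 x).
transitivity (M^-1 * (a0 * m0) + M^-1 * (a1 * n0) + M^-1 * (b0 * m1) + M^-1 * (b1 * n1));
  last by field.
have inS1 i : (i \notin S1) = (i \in O) by rewrite finset.in_setC.
have inO' i : (i \notin O) -> (i \in S1) by rewrite finset.in_setC negbK.
rewrite -(@sum_prod_independent _ _ O (fun x => A x x) (fun x => D x (swp finset.set0 x))); first last.
- by move=> x x' h; apply: Ds => i iO; have [h1 h2] := h i iO; rewrite /= ?ffunE ?inE ?h1 ?h2.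
- by move=> x x' h; apply: As => i; rewrite inS1 => /h.
rewrite -(@sum_prod_independent _ _ O (fun x => A (swp O x) x) (fun x => E x (swp finset.set0 x))); first last.
- by move=> x x' h; apply: Es => i iO; have [h1 h2] := h i iO; rewrite /= ?ffunE ?inE ?h1 ?h2.
- by move=> x x' h; apply: As => i; rewrite inS1 => /h [h1 h2]; rewrite /= ?ffunE ?h1 ?h2.
rewrite -(@sum_prod_independent _ _ O (fun x => B (swp S1 x) x) (fun x => D x (swp S1 x))); first last.
- by move=> x x' h; apply: Ds => i iO; have [h1 h2] := h i iO; rewrite /= ?ffunE ?h1 ?h2.
- by move=> x x' h; apply: Bs => i; rewrite inS1 => /h [h1 h2]; rewrite /= ?ffunE ?h1 ?h2.
rewrite -(@sum_prod_independent _ _ O (fun x => B (swp full x) x) (fun x => E x (swp S1 x))); first last.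
- by move=> x x' h; apply: Es => i iO; have [h1 h2] := h i iO; rewrite /= ?ffunE ?h1 ?h2.
- by move=> x x' h; apply: Bs => i; rewrite inS1 => /h [h1 h2]; rewrite /= ?ffunE ?h1 ?h2.
rewrite pairingC -!big_split; apply: eq_bigr => x _ /=.
have EO : E x (swp finset.set0 x) = E x (swp O x).
  by apply: Es => // i /negbTE iO; rewrite /= !ffunE iO inE.
have Ef : E x (swp S1 x) = E x (swp full x).
  by apply: Es => // i iO; rewrite /= !ffunE (inO' i iO) inE.
rewrite EO Ef.
have s0 : swp finset.set0 x = x by apply: eq_qb2 => i; rewrite /= !ffunE inE.
rewrite s0.
(* For fixed [x] only [x] itself and its images under the three other swaps contribute; written as
   delta sums over [y], the four terms can be compared entrywise with the product of [Y] and [Z]. *)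
rewrite -(sum_delta x (fun y => A y x * D x y)) -(sum_delta (swp O x) (fun y => A y x * E x y)).
rewrite -(sum_delta (swp S1 x) (fun y => B y x * D x y)) -(sum_delta (swp full x) (fun y => B y x * E x y)).
rewrite -!big_split; apply: eq_bigr => y _ /=; rewrite ZE YE.
have dO1 : [disjoint O & S1]%B by rewrite -setI_eq0 finset.setIC finset.setICr.
have d1O : [disjoint S1 & O]%B by rewrite -setI_eq0 finset.setICr.
rewrite !(eq_res_split S1 _ y).
have [-> ->] := res_swp_disjoint x d1O; have [-> ->] := res_swp_disjoint x dO1.
have [-> ->] := res_swp_sub x (subxx O); have [-> ->] := res_swp_sub x (subxx S1).
have [-> ->] := res_swp_sub x (finset.subsetT O); have [-> ->] := res_swp_sub x (finset.subsetT S1).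
rewrite -!mulnb !natrM; ring.
Qed.

End Layout.

(** * Channels modulo the identity and the full swap *)

Section Circuits.
Variables (R : realType) (N : nat).
Hypothesis N5 : (5 <= N)%N.
Local Notation C := R[i].
Local Notation Q2 := (qb N * qb N)%type.
Local Notation F := (@swapop R N).
Local Notation S1 := (S_23N N).
Local Notation S2 := (S_12 N).
Local Notation S3 := (S_134N N).
Local Notation O := (~: S_23N N).
Local Notation full := [set: 'I_N]%SET.
Implicit Types (X Y Z : op R Q2) (Phi Psi : chan R Q2) (S T : {set 'I_N}).

(** The first coefficient of [twirl_swap]; the second is the same function with its arguments
    exchanged. *)
Definition swap_weight (t r : R) : R := t * (1 - r ^+ 2) / (1 - (t * r) ^+ 2).

Definition lin_chan Psi := forall X Y (c c' : C),
  Psi (fun x y => c * X x y + c' * Y x y) = fun x y => c * Psi X x y + c' * Psi Y x y.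

Definition unital_chan Psi := Psi (F finset.set0) = F finset.set0 /\ Psi (F full) = F full.

Definition sym_chan Psi := forall X Y, pairing (Psi X) Y = pairing X (Psi Y).

(** Congruence to c F_T modulo the span of the identity and the full swap. All twirls fix that span,
    so congruences compose. *)
Definition swap_cong (c : R) T Y := exists a b : C,
  Y = fun x y => c%:C%C * F T x y + 1 * (a * F finset.set0 x y + b * F full x y).

Lemma lin_chan_comp Phi Psi : lin_chan Phi -> lin_chan Psi -> lin_chan (Phi \o Psi).
Proof. by move=> h1 h2 X Y c c' /=; rewrite h2 h1. Qed.

Lemma unital_chan_comp Phi Psi : unital_chan Phi -> unital_chan Psi -> unital_chan (Phi \o Psi).
Proof. by move=> [h1 h2] [h3 h4]; split; rewrite /= ?h3 ?h4. Qed.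

Lemma twirl_unital S Phi : is_twirl S Phi -> unital_chan Phi.
Proof.
move=> PT; split; apply: twirl_id PT _; apply: commutant_swap; apply/orP.
  by right; rewrite -setI_eq0 finset.setI0.
by left; exact: finset.subsetT.
Qed.

(** When [T] and [S] cover all qubits, the enlarged swap is the full one and drops out;
    [swap_cong_grow] is the opposite case, where the reduced swap is the identity. *)
Lemma swap_cong_keep S T Phi c Y : is_twirl S Phi -> S != finset.set0 ->
  swap_cong c T Y -> T :|: S = full ->
  swap_cong (c * swap_weight ((2^-1) ^+ #|T :&: S|) ((2^-1) ^+ #|S :\: T|)) (T :\: S) (Phi Y).
Proof.
move=> PT S0 [a [b ->]] TS; have [u1 u2] := twirl_unital PT.
rewrite !(twirl_lin _ _ _ _ PT) (twirl_swap PT S0 erefl erefl) u1 u2 TS.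
set r := _ * (1 - (2^-1) ^+ #|T :&: S| ^+ 2) / _.
exists a, (b + c%:C%C * r%:C%C).
apply/funext => x; apply/funext => y; rewrite -/(swap_weight _ _).
by rewrite (rmorphM (real_complex R) c); ring.
Qed.

Lemma swap_cong_grow S T Phi c Y : is_twirl S Phi -> S != finset.set0 ->
  swap_cong c T Y -> T :\: S = finset.set0 ->
  swap_cong (c * swap_weight ((2^-1) ^+ #|S :\: T|) ((2^-1) ^+ #|T :&: S|)) (T :|: S) (Phi Y).
Proof.
move=> PT S0 [a [b ->]] TS; have [u1 u2] := twirl_unital PT.
rewrite !(twirl_lin _ _ _ _ PT) (twirl_swap PT S0 erefl erefl) u1 u2 TS.
set r := _ * (1 - (2^-1) ^+ #|S :\: T| ^+ 2) / _.
exists (a + c%:C%C * r%:C%C), b.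
apply/funext => x; apply/funext => y.
rewrite [_ ^+ #|T :&: S| * _ ^+ #|S :\: T|]mulrC -/(swap_weight _ _).
by rewrite (rmorphM (real_complex R) c); ring.
Qed.

(* A channel of this kind is determined by [la]. *)
Definition mixing_chan (la : R) Psi := [/\ sym_chan Psi, unital_chan Psi,
  forall X, in_swap4 (Psi X) &
  forall Y, in_swap4 Y -> exists a b : C,
    Psi Y = fun x y => la%:C%C * Y x y + 1 * (a * F finset.set0 x y + b * F full x y)].

(** The remainders are fixed by [Psi], so they accumulate while the eigenvalues multiply. Exponents
    start at 1 because the identity channel does not map into the span of the four swaps. *)
Lemma mixing_chan_iter la Psi d : mixing_chan la Psi -> mixing_chan (la ^+ d.+1) (iter d.+1 Psi).
Proof.
move=> PM; have [s1 u1 r1 e1] := PM; elim: d => [|d [s2 u2 r2 e2]]; first by rewrite expr1.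
split.
- by move=> X Y; rewrite [in LHS]iterS [in RHS]iterSr s1 s2.
- by case: u1 u2 => [h1 h2] [h3 h4]; split; rewrite iterS ?h3 ?h4.
- by move=> X; rewrite iterS.
- move=> Y Y4; have [a [b E]] := e2 Y Y4; have [a' [b' E']] := e1 _ (r2 Y).
  exists (a' + la%:C%C * a), (b' + la%:C%C * b); rewrite iterS E' E.
  by apply/funext => x; apply/funext => y; rewrite (exprS la d.+1) (rmorphM (real_complex R) la (la ^+ d.+1)); ring.
Qed.

Lemma swap_cong_eigen la Psi : lin_chan Psi -> unital_chan Psi ->
  swap_cong la O (Psi (F O)) -> swap_cong la S1 (Psi (F S1)) ->
  forall Y, in_swap4 Y -> exists a b : C,
    Psi Y = fun x y => la%:C%C * Y x y + 1 * (a * F finset.set0 x y + b * F full x y).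
Proof.
move=> Pl [u1 u2] [a [b E]] [a' [b' E']] Y [c0 [c1 [c2 [c3 ->]]]].
rewrite /swap4 !Pl u1 u2 E E'.
exists (c0 - la%:C%C * c0 + c1 * a + c2 * a'), (c3 - la%:C%C * c3 + c1 * b + c2 * b').
by apply/funext => x; apply/funext => y; ring.
Qed.

Lemma swap_cong_self T : swap_cong 1 T (F T).
Proof.
exists 0, 0; apply/funext => x; apply/funext => y; rewrite rmorph1; ring.
Qed.

(** A gate whose support contains qubit 1 has its commutant inside that of the unitaries on qubit 1,
    which is all that [commutant_S1_reduce] asks of a test operator. *)
Lemma twirl_reduce S Phi Y : is_twirl S Phi -> O \subset S -> commutant S1 Y ->
  exists2 v, in_swap4 v & Phi Y = Phi v.
Proof.
move=> PT OS YW; have [v v4 vY] := commutant_S1_reduce N5 YW; exists v => //.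
have [PW Pp] := PT; apply: (twirl_unique PT (PW v)) => Z ZW.
rewrite Pp //; apply: vY => V [Vu [W [Wd VW]]]; apply: ZW; split => //.
(* A unitary on qubit 1 is local on [S]: the identity on the rest of [S] is moved into its local
   part. *)
exists (fun x y : qb N => ([forall i in S :\: O, x i == y i])%:R * W x y); split.
  move=> x y x' y' /forallP hx /forallP hy.
  have hx' i : i \in S -> x i = x' i by move=> iS; have /implyP/(_ iS)/eqP := hx i.
  have hy' i : i \in S -> y i = y' i by move=> iS; have /implyP/(_ iS)/eqP := hy i.
  congr ((nat_of_bool _)%:R * _).
    apply: eq_forallb => i; case: (boolP (i \in S :\: O)) => //= /finset.setDP[iS _].
    by rewrite hx' ?hy'.
  apply: Wd; apply/forallP => i; apply/implyP => iO; apply/eqP.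
    by apply: hx'; exact: (fintype.subsetP OS).
  by apply: hy'; exact: (fintype.subsetP OS).
move=> x y; rewrite VW mulrA -natrM mulnb; congr ((nat_of_bool _)%:R * _).
apply/forallP/andP => [h|[/forallP h1 /forallP h2] i].
  split; apply/forallP => i; apply/implyP => iS; have /implyP := h i; apply.
    by move: iS; rewrite !finset.in_setC; apply: contra => iO; apply: (fintype.subsetP OS); rewrite finset.in_setC.
  by move/finset.setDP: iS => [_ iO]; rewrite finset.in_setC.
apply/implyP; rewrite finset.in_setC => iO.
have [iS|iS] := boolP (i \in S).
  by have /implyP := h2 i; apply; rewrite finset.in_setD iO.
by have /implyP := h1 i; apply; rewrite finset.in_setC.
Qed.

Lemma in_swap4_commutant (v : op R Q2) : in_swap4 v -> commutant S1 v.
Proof.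
move=> [c0 [c1 [c2 [c3 ->]]]].
apply: (@commutant_lin _ _ S1 (fun x y => c0 * F finset.set0 x y + c1 * F O x y)
  (fun x y => c2 * F S1 x y + c3 * F full x y)); apply: commutant_lin; apply: commutant_swap;
  apply/orP.
- by right; rewrite -setI_eq0 finset.setI0.
- by right; rewrite -setI_eq0 finset.setICr.
- by left.
- by left; exact: finset.subsetT.
Qed.

(** The first outer twirl lands in the commutant of [S1] and the gate [Phi] after it reduces this to
    the four swaps, so the range is found before [G] is known. [G] is the identity for C' and
    [Phi2 \o Phi3] for C. *)
Lemma sandwich_mixing la Phi1 G S Phi : is_twirl S1 Phi1 -> is_twirl S Phi -> O \subset S ->
  lin_chan (G \o Phi) -> unital_chan (G \o Phi) -> sym_chan (G \o Phi) ->
  swap_cong la O (Phi1 (G (Phi (F O)))) -> swap_cong la S1 (Phi1 (G (Phi (F S1)))) ->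
  mixing_chan la (Phi1 \o (G \o Phi) \o Phi1).
Proof.
move=> T1 TP OS Gl Gu Gs EO ES.
have T1l : lin_chan Phi1 by move=> X Y c c'; exact: twirl_lin T1.
have T1u := twirl_unital T1.
have fixO : Phi1 (F O) = F O.
  by apply: twirl_id T1 _; apply: commutant_swap; rewrite -setI_eq0 finset.setICr eqxx orbT.
have fixS : Phi1 (F S1) = F S1.
  by apply: twirl_id T1 _; apply: commutant_swap; rewrite subxx.
set Psi := _ \o _ \o _.
have Pu : unital_chan Psi by do 2![apply: unital_chan_comp => //].
have eig : forall Y, in_swap4 Y -> exists a b : C,
    Psi Y = fun x y => la%:C%C * Y x y + 1 * (a * F finset.set0 x y + b * F full x y).
  apply: swap_cong_eigen => //; first by do 2![apply: lin_chan_comp => //].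
    by rewrite /Psi /= fixO.
  by rewrite /Psi /= fixS.
split => //.
  move=> X Y; rewrite /Psi -[LHS]/(pairing (Phi1 ((G \o Phi) (Phi1 X))) Y).
  by rewrite (twirl_sym _ _ T1) Gs (twirl_sym _ _ T1).
move=> X; have XW : commutant S1 (Phi1 X) by case: T1 => + _; apply.
have [v v4 vE] := twirl_reduce TP OS XW.
have -> : Psi X = Psi v.
  by rewrite /Psi /= vE (twirl_id T1 (in_swap4_commutant v4)).
have [a [b ->]] := eig v v4; move: v4 => [c0 [c1 [c2 [c3 ->]]]].
exists (la%:C%C * c0 + a), (la%:C%C * c1), (la%:C%C * c2), (la%:C%C * c3 + b).
by apply/funext => x; apply/funext => y; rewrite /swap4; ring.
Qed.

(** The Haar moment is the case of eigenvalue 0, so [mixing_block] describes it together with the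
    circuits. *)
Lemma haar_mixing Phi : is_twirl full Phi -> mixing_chan 0 Phi.
Proof.
move=> PT.
have full0 : full != finset.set0.
  have N0 : (0 < N)%N by apply: leq_trans N5.
  by apply/set0Pn; exists (Ordinal N0); rewrite inE.
have span X : exists a b : C, Phi X = fun x y => a * F finset.set0 x y + b * F full x y.
  have XW : commutant full (Phi X) by case: PT => + _; apply.
  have [A [B [As Bs YE]]] := commutant_form full0 XW.
  have cst (D : op R Q2) : off_support full D -> forall x y x' y', D x y = D x' y'.
    by move=> Ds x y x' y'; apply: Ds => i; rewrite inE.
  pose x0 : Q2 := ([ffun=> false], [ffun=> false]).
  exists (A x0 x0), (B x0 x0); apply/funext => x; apply/funext => y.
  rewrite YE (cst _ As x y x0 x0) (cst _ Bs x y x0 x0) mulrC [X in _ + X]mulrC.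
  have resT (u w : qb N) : (res full u == res full w) = (u == w).
    by apply/res_eqP/eqP => [h|->//]; apply/ffunP => i; apply: h; rewrite inE.
  rewrite !resT; congr (_ * (nat_of_bool _)%:R + _ * (nat_of_bool _)%:R).
    rewrite -xpair_eqE -!surjective_pairing; congr (_ == _).
    by apply: eq_qb2 => i; rewrite /= !ffunE inE.
  rewrite -(xpair_eqE x.1 y.2 x.2 y.1) -surjective_pairing; congr (_ == _).
  by apply: eq_qb2 => i; rewrite /= !ffunE inE.
split.
- by move=> X Y; exact: twirl_sym PT.
- exact: twirl_unital PT.
- move=> X; have [a [b ->]] := span X; exists a, 0, 0, b.
  by apply/funext => x; apply/funext => y; rewrite /swap4; ring.
- move=> Y _; have [a [b ->]] := span Y; exists a, b.
  by apply/funext => x; apply/funext => y; rewrite rmorph0; ring.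
Qed.

End Circuits.

(** * Eigenvalues of the two circuits *)

Section Eigenvalues.
Variables (R : realType) (N : nat).
Hypothesis N5 : (5 <= N)%N.
Local Notation Q2 := (qb N * qb N)%type.
Local Notation F := (@swapop R N).
Local Notation S1 := (S_23N N).
Local Notation S2 := (S_12 N).
Local Notation S3 := (S_134N N).
Local Notation O := (~: S_23N N).
Local Notation Q := (~: S_134N N).
Local Notation L := (~: S_12 N).
Local Notation full := [set: 'I_N]%SET.
Implicit Types (Phi : chan R Q2).

(** All supports distinguish only qubit 1, qubit 2 and the others, so set identities reduce to three
    cases. *)
Ltac setcase := apply/setP => -[[|[|i]] Hi]; rewrite !inE //=.

Lemma cardQ : #|Q| = 1%N.
Proof.
have N1 : (1 < N)%N by apply: leq_trans N5.
rewrite (_ : Q = [set Ordinal N1]%SET) ?cards1 //; apply/setP => i.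
by rewrite !inE negbK.
Qed.

Lemma cardL : #|L| = (N - 2)%N.
Proof.
have N0 : (0 < N)%N by apply: leq_trans N5.
have N1 : (1 < N)%N by apply: leq_trans N5.
rewrite cardsCs finset.setCK card_ord (_ : S2 = [set Ordinal N0; Ordinal N1]%SET) ?cards2 //.
by setcase.
Qed.

Let eta : R := (2^-1) ^+ (N - 2).
Let a := swap_weight eta 2^-1.
Let b := swap_weight 2^-1 eta.
Let w : R := swap_weight 2^-1 2^-1.

Lemma S1_neq0 : S1 != finset.set0.
Proof.
have N1 : (1 < N)%N by apply: leq_trans N5.
by apply/set0Pn; exists (Ordinal N1); rewrite inE.
Qed.

Lemma S2_neq0 : S2 != finset.set0.
Proof.
have N1 : (1 < N)%N by apply: leq_trans N5.
by apply/set0Pn; exists (Ordinal N1); rewrite inE.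
Qed.

Lemma S3_neq0 : S3 != finset.set0.
Proof.
have N1 : (0 < N)%N by apply: leq_trans N5.
by apply/set0Pn; exists (Ordinal N1); rewrite inE.
Qed.

Section Circuit.
Variables (Phi1 Phi2 Phi3 : chan R Q2).
Hypotheses (T1 : is_twirl S1 Phi1) (T2 : is_twirl S2 Phi2) (T3 : is_twirl S3 Phi3).

Lemma keep_step S T U A B t r Phi c Y : is_twirl S Phi -> S != finset.set0 ->
  T :|: S = full -> T :\: S = U -> T :&: S = A -> S :\: T = B ->
  (2^-1) ^+ #|A| = t :> R -> (2^-1) ^+ #|B| = r :> R ->
  swap_cong c T Y -> swap_cong (c * swap_weight t r) U (Phi Y).
Proof.
by move=> PT S0 e1 e2 e3 e4 <- <- h; have := swap_cong_keep PT S0 h e1; rewrite e2 e3 e4.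
Qed.

Lemma grow_step S T U A B t r Phi c Y : is_twirl S Phi -> S != finset.set0 ->
  T :\: S = finset.set0 -> T :|: S = U -> T :&: S = A -> S :\: T = B ->
  (2^-1) ^+ #|A| = t :> R -> (2^-1) ^+ #|B| = r :> R ->
  swap_cong c T Y -> swap_cong (c * swap_weight r t) U (Phi Y).
Proof.
by move=> PT S0 e1 e2 e3 e4 <- <- h; have := swap_cong_grow PT S0 h e1; rewrite e2 e3 e4.
Qed.

Let hO : (2^-1) ^+ #|O| = 2^-1 :> R. Proof. by rewrite cardO. Qed.
Let hQ : (2^-1) ^+ #|Q| = 2^-1 :> R. Proof. by rewrite cardQ. Qed.
Let hL : (2^-1) ^+ #|L| = eta. Proof. by rewrite cardL. Qed.

Let O_S3 : O \subset S3.
Proof. by apply/fintype.subsetP => -[[|[|i]] Hi]; rewrite !inE. Qed.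

Let O_S2 : O \subset S2.
Proof. by apply/fintype.subsetP => -[[|[|i]] Hi]; rewrite !inE. Qed.

(** Modulo trivial terms, [F O] goes to [F S3] and back, and [F S1] goes to [F Q] and back, each
    step with weight [a]. The steps are applied from the outermost gate inwards. *)
Lemma mixing_C' : mixing_chan (a ^+ 2) (Phi1 \o Phi3 \o Phi1).
Proof.
rewrite -[_ ^+ 2]mul1r [a ^+ 2]expr2 mulrA.
apply: (@sandwich_mixing _ _ N5 _ Phi1 id S3 Phi3) => //.
- by move=> X Y c c'; exact: twirl_lin T3.
- exact: twirl_unital T3.
- by move=> X Y; exact: twirl_sym T3.
- apply: (keep_step (A := L) (B := Q) (T := S3) T1 S1_neq0) => //; try setcase.
  apply: (grow_step (A := O) (B := L) (T := O) T3 S3_neq0) => //; try setcase.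
  exact: swap_cong_self.
- apply: (grow_step (A := Q) (B := L) (T := Q) T1 S1_neq0) => //; try setcase.
  apply: (keep_step (A := L) (B := O) (T := S1) T3 S3_neq0) => //; try setcase.
  exact: swap_cong_self.
Qed.

(** [F O] travels through [S2], [Q], [S2] and back to [O]; [F S1] travels through [L], [S3], [L] and
    back to [S1]. Along both routes the weights are [w], [b], [w], [b]. *)
Lemma mixing_C : mixing_chan ((w * b) ^+ 2) (Phi1 \o Phi2 \o Phi3 \o Phi2 \o Phi1).
Proof.
have -> : (w * b) ^+ 2 = 1 * w * b * w * b by ring.
apply: (@sandwich_mixing _ _ N5 _ Phi1 (Phi2 \o Phi3) S2 Phi2) => //.
- have l2 : lin_chan Phi2 by move=> X Y c c'; exact: twirl_lin T2.
  have l3 : lin_chan Phi3 by move=> X Y c c'; exact: twirl_lin T3.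
  exact: lin_chan_comp (lin_chan_comp l2 l3) l2.
- have u2 := twirl_unital T2; have u3 := twirl_unital T3.
  exact: unital_chan_comp (unital_chan_comp u2 u3) u2.
- by move=> X Y /=; rewrite (twirl_sym _ _ T2) (twirl_sym _ _ T3) (twirl_sym _ _ T2).
- apply: (keep_step (A := Q) (B := L) (T := S2) T1 S1_neq0) => //; try setcase.
  apply: (grow_step (A := Q) (B := O) (T := Q) T2 S2_neq0) => //; try setcase.
  apply: (keep_step (A := O) (B := L) (T := S2) T3 S3_neq0) => //; try setcase.
  apply: (grow_step (A := O) (B := Q) (T := O) T2 S2_neq0) => //; try setcase.
  exact: swap_cong_self.
- apply: (grow_step (A := L) (B := Q) (T := L) T1 S1_neq0) => //; try setcase.
  apply: (keep_step (A := O) (B := Q) (T := S3) T2 S2_neq0) => //; try setcase.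
  apply: (grow_step (A := L) (B := O) (T := L) T3 S3_neq0) => //; try setcase.
  apply: (keep_step (A := Q) (B := O) (T := S1) T2 S2_neq0) => //; try setcase.
  exact: swap_cong_self.
Qed.

End Circuit.

(** After clearing the common denominator the claim is (3/4) eta < (1/5) (1 - eta^2). At N = 4 both
    sides equal 3/16 and the eigenvalues coincide; from N = 5 on, eta <= 1/8. *)
Lemma eigenvalue_lt : 0 < a ^+ 2 /\ a ^+ 2 < (w * b) ^+ 2.
Proof.
have e0 : 0 < eta by rewrite exprn_gt0 ?invr_gt0.
have e1 : eta <= 8^-1.
  rewrite /eta; have -> : 8^-1 = (2^-1) ^+ 3 :> R by field.
  by apply: ler_wiXn2l; rewrite ?invr_ge0 ?invf_le1 ?ler1n // leq_subRL ?(leq_trans _ N5).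
have wE : w = 2 / 5 by rewrite /w /swap_weight; field.
have d0 : 0 < 1 - (eta * 2^-1) ^+ 2 by nra.
have aE : a = eta * (3 / 4) / (1 - (eta * 2^-1) ^+ 2) by rewrite /a /swap_weight; field; lra.
have bE : b = 2^-1 * (1 - eta ^+ 2) / (1 - (eta * 2^-1) ^+ 2).
  by rewrite /b /swap_weight [2^-1 * eta]mulrC.
have a0 : 0 < a by rewrite aE divr_gt0 //; lra.
have ab : a < w * b.
  rewrite wE aE bE [ltRHS]mulrA ltr_pM2r ?invr_gt0 //; nra.
split; first by rewrite exprn_gt0.
by rewrite ltrXn2r // ltW // (lt_trans a0).
Qed.

End Eigenvalues.

(** * Separation of the block channels *)

Section Separation.
Variables (R : realType) (T : finType) (p : bool * bool -> op R T) (d : bool * bool -> R).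
Hypothesis pM : forall i j x y, opmul (p i) (p j) x y = (i == j)%:R * p i x y.
Hypothesis pH : forall i x y, conjc (p i x y) = p i y x.
Hypothesis ptr : forall i, optr (p i) = (d i)%:C%C.
Hypothesis d_gt0 : forall i, 0 < d i.

Definition parity (i : bool * bool) : bool := i.1 (+) i.2.
Definition dim_class (b : bool) : R := \sum_(i | parity i == b) d i.
(** The parity is that of the sign of the full swap, so the classes are the symmetric and the
    antisymmetric subspace; the kernel replaces an operator by its average on each of them. *)
Definition haar_kernel (i j : bool * bool) : R :=
  (parity i == parity j)%:R / dim_class (parity i).
Definition local_kernel (i j : bool * bool) : R := (i == j)%:R / d i.
Definition gap_kernel i j := local_kernel i j - haar_kernel i j.
Definition mixed_kernel (la : R) i j := la * local_kernel i j + (1 - la) * haar_kernel i j.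

Lemma dim_class_ge i : d i <= dim_class (parity i).
Proof. by rewrite /dim_class (bigD1 i) //= lerDl sumr_ge0 // => j _; exact: ltW. Qed.

Lemma dim_class_gt0 b : 0 < dim_class b.
Proof. exact: lt_le_trans (d_gt0 (b, false)) (eq_ind_r (fun c => _ <= dim_class c) (dim_class_ge (b, false)) (esym (addbF b))). Qed.

Lemma block_chan_add k k' X x y : block_chan p (fun i j => k i j + k' i j) X x y =
  block_chan p k X x y + block_chan p k' X x y.
Proof.
rewrite /block_chan -big_split; apply: eq_bigr => i _; rewrite -big_split.
by apply: eq_bigr => j _; rewrite rmorphD /=; ring.
Qed.

Lemma block_chan_scale c k X x y : block_chan p (fun i j => c * k i j) X x y =
  c%:C%C * block_chan p k X x y.
Proof.
rewrite /block_chan mulr_sumr; apply: eq_bigr => i _; rewrite mulr_sumr.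
by apply: eq_bigr => j _; rewrite rmorphM /=; ring.
Qed.

Lemma block_chan_gap la : chan_sub (block_chan p (mixed_kernel la)) (block_chan p (mixed_kernel 0)) =
  block_chan p (fun i j => la * gap_kernel i j).
Proof.
apply/funext => X; apply/funext => x; apply/funext => y; rewrite /chan_sub.
transitivity (block_chan p (mixed_kernel la) X x y +
  (-1)%:C%C * block_chan p (mixed_kernel 0) X x y); first by rewrite rmorphN1 mulN1r.
rewrite -block_chan_scale -block_chan_add; congr (block_chan p _ X x y).
by apply/funext => i; apply/funext => j; rewrite /mixed_kernel /gap_kernel; ring.
Qed.

Lemma gap_diamond_le : exists2 K : R, 0 <= K & forall l eps, 0 < l -> l * K <= eps ->
  diamond_le (block_chan p (fun i j => l * gap_kernel i j)) eps.
Proof.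
have [K K0 hK] := block_chan_diamond_bounded p gap_kernel; exists K => // l eps l0 lK X r Xr r1 s.
move=> /(trace_norm_scale (c := l^-1)); rewrite invr_ge0 (ltW l0) => /(_ isT) h.
apply: le_trans lK; rewrite -ler_pdivrMl //; apply: hK Xr r1 _.
suff <- : (fun x y => (l^-1)%:C%C * tens_id (B := T)
    (block_chan p (fun i j => l * gap_kernel i j)) X x y) = tens_id (B := T) (block_chan p gap_kernel) X.
  exact: h.
apply/funext => x; apply/funext => y; rewrite /tens_id block_chan_scale mulrA -rmorphM.
by rewrite mulVf ?gt_eqF // rmorph1 mul1r.
Qed.

Lemma gap_diamond_not_le (x0 : T) l eps : 0 < l -> eps < l ->
  ~ diamond_le (block_chan p (fun i j => l * gap_kernel i j)) eps.
Proof.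
move=> l0 el.
(* A difference of two normalised blocks of the same parity: its trace on the class vanishes, so the
   Haar part kills it while the local part fixes it. The factors 1/2 make its trace norm 1. *)
pose y (i : bool * bool) : R := (if i == (false, true) then 2^-1 else
  if i == (true, false) then - 2^-1 else 0) / d i.
have dn i : d i != 0 by rewrite gt_eqF.
have sum4 (f : bool * bool -> R) : \sum_i f i = f (true, true) + f (true, false)
    + (f (false, true) + f (false, false)).
  by rewrite sum_pair !big_bool.
have y1 : \sum_i `|y i| * d i = 1.
  under eq_bigr => i _ do rewrite /y normrM normfV (gtr0_norm (d_gt0 i)) divfK //.
  by rewrite sum4 /= normrN normr0 ger0_norm ?invr_ge0 //; field.
have yE : (fun i => \sum_j l * gap_kernel i j * (y j * d j)) = (fun i => l * y i).
  apply/funext => i; rewrite sum4 /y /= !mul0r !mulr0 add0r addr0 -!mulrA !mulVf // !mulr1.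
  have Dn b : dim_class b != 0 by rewrite gt_eqF // dim_class_gt0.
  rewrite /gap_kernel /local_kernel /haar_kernel /parity.
  by case: i => [[] []] /=; field; rewrite ?Dn ?dn.
move=> h.
have X1 := block_op_trace_norm pM pH ptr x0 y; rewrite y1 in X1.
have := h _ _ X1 (lexx 1) l; rewrite tens_id_block_op (block_chan_op pM ptr) yE.
have X2 := block_op_trace_norm pM pH ptr x0 (fun i => l * y i).
have e : \sum_i `|l * y i| * d i = l.
  by rewrite -[RHS]mulr1 -y1 mulr_sumr; apply: eq_bigr => i _; rewrite normrM (gtr0_norm l0) mulrA.
by rewrite e in X2; move=> /(_ X2); rewrite leNgt el.
Qed.

Lemma multiplicative_blockE la eps :
  chan_add (chan_scale eps (block_chan p (mixed_kernel 0)))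
    (chan_sub (block_chan p (mixed_kernel la)) (block_chan p (mixed_kernel 0))) =
  block_chan p (fun i j => eps * haar_kernel i j + la * gap_kernel i j) /\
  chan_sub (chan_scale eps (block_chan p (mixed_kernel 0)))
    (chan_sub (block_chan p (mixed_kernel la)) (block_chan p (mixed_kernel 0))) =
  block_chan p (fun i j => eps * haar_kernel i j + (- la) * gap_kernel i j).
Proof.
have k0 : mixed_kernel 0 = haar_kernel.
  by apply/funext => i; apply/funext => j; rewrite /mixed_kernel mul0r add0r subr0 mul1r.
rewrite block_chan_gap k0; split; apply/funext => X; apply/funext => x; apply/funext => y.
  by rewrite /chan_add /chan_scale complexr0 block_chan_add !block_chan_scale.
rewrite {1}/chan_sub /chan_scale complexr0 block_chan_add !block_chan_scale.
by rewrite rmorphN mulNr.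
Qed.

(** With the plus sign, the entries between distinct blocks of one class require l <= eps. With the
    minus sign the danger is on the diagonal, where it is enough that l times the ratio of class to
    block dimension is at most eps; [K] sums these ratios. *)
Lemma gap_cp : exists2 K : R, 0 <= K & forall l eps, 0 <= l -> l <= eps -> l * K <= eps ->
  is_cp (block_chan p (fun i j => eps * haar_kernel i j + l * gap_kernel i j)) /\
  is_cp (block_chan p (fun i j => eps * haar_kernel i j + (- l) * gap_kernel i j)).
Proof.
pose K : R := \sum_i dim_class (parity i) / d i.
have K0 i : 0 <= dim_class (parity i) / d i by rewrite divr_ge0 // ltW // dim_class_gt0.
exists K; first by apply: sumr_ge0 => i _; exact: K0.
move=> l eps l0 le lK.
have Dp i := dim_class_gt0 (parity i).
have eps0 : 0 <= eps by apply: le_trans le.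
split; apply: (block_chan_cp pM pH) => i j; rewrite /gap_kernel /local_kernel /haar_kernel.
  have -> : eps * ((parity i == parity j)%:R / dim_class (parity i)) + l * ((i == j)%:R / d i -
    (parity i == parity j)%:R / dim_class (parity i)) = (eps - l) * ((parity i == parity j)%:R /
    dim_class (parity i)) + l * ((i == j)%:R / d i) by ring.
  by rewrite addr_ge0 // mulr_ge0 ?subr_ge0 ?divr_ge0 ?ler0n // ltW.
have [<-|ij] := eqVneq i j; last first.
  by rewrite mul0r sub0r mulrNN addr_ge0 // mulr_ge0 ?divr_ge0 ?ler0n // ltW.
rewrite !eqxx.
have KD : l * (dim_class (parity i) / d i) <= eps.
  apply: le_trans lK; apply: ler_wpM2l => //; rewrite /K (bigD1 i) //= lerDl.
  by apply: sumr_ge0 => j' _; exact: K0.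
have -> : eps * (true%:R / dim_class (parity i)) + - l * (true%:R / d i - true%:R / dim_class (parity i))
  = (eps - l * (dim_class (parity i) / d i) + l) / dim_class (parity i).
  by rewrite /=; field; rewrite !gt_eqF.
by apply: divr_ge0; [rewrite addr_ge0 // subr_ge0|exact: ltW].
Qed.

(** Between the two distinct blocks of odd parity the local kernel vanishes, and the entry is eps -
    l over the class dimension. *)
Lemma gap_not_cp l eps : eps < l ->
  ~ is_cp (block_chan p (fun i j => eps * haar_kernel i j + l * gap_kernel i j)).
Proof.
move=> el; apply: (@block_chan_not_cp _ _ _ p d pM pH ptr d_gt0 _ (false, true) (true, false)).
rewrite /gap_kernel /local_kernel /haar_kernel /= mul0r sub0r mulrN -mulrBl.
by rewrite pmulr_llt0 ?subr_lt0 // mul1r invr_gt0 dim_class_gt0.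
Qed.

Lemma kernel_separation (x0 : T) la la' : 0 < la' -> la' < la ->
  exists (d : nat) (eps : R), [/\ 0 < eps,
    diamond_le (block_chan p (fun i j => la' ^+ d.+1 * gap_kernel i j)) eps /\
    ~ diamond_le (block_chan p (fun i j => la ^+ d.+1 * gap_kernel i j)) eps,
    is_cp (block_chan p (fun i j => eps * haar_kernel i j + la' ^+ d.+1 * gap_kernel i j)) /\
    is_cp (block_chan p (fun i j => eps * haar_kernel i j + (- la' ^+ d.+1) * gap_kernel i j)) &
    ~ is_cp (block_chan p (fun i j => eps * haar_kernel i j + la ^+ d.+1 * gap_kernel i j))].
Proof.
move=> l'0 l'l; have l0 := lt_trans l'0 l'l.
have [K K0 hK] := gap_diamond_le; have [K' K'0 hK'] := gap_cp.
pose q := la' / la.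
have q0 : 0 <= q by rewrite divr_ge0 // ltW.
have q1 : `|q| < 1 by rewrite ger0_norm // ltr_pdivrMr // mul1r.
(* A single factor K + K' + 1 serves three demands: [K] for the diamond bound, [K'] for complete
   positivity, and 1 for the condition l <= eps of [gap_cp]. *)
pose e : R := (2 * (K + K' + 1))^-1.
have e0 : 0 < e by rewrite invr_gt0 mulr_gt0 // ltr_wpDl // addr_ge0.
have /cvgrPdist_lt /(_ e e0) [n _ /(_ n (leqnn n))] := cvg_expr q1.
rewrite /= sub0r normrN ger0_norm ?exprn_ge0 // => qn.
have bound : la' ^+ n.+1 * (K + K' + 1) <= la ^+ n.+1 / 2.
  have -> : la' = q * la by rewrite /q divfK ?gt_eqF.
  rewrite exprMn mulrAC mulrC ler_pM2l ?exprn_gt0 // exprS.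
  have qe : q ^+ n * (K + K' + 1) <= 2^-1.
    apply: (@le_trans _ _ (e * (K + K' + 1))); first by apply: ler_wpM2r (ltW qn); rewrite !addr_ge0.
    by rewrite /e invfM -mulrA mulVf ?mulr1 // gt_eqF // ltr_wpDl // addr_ge0.
  apply: le_trans qe; rewrite -mulrA ler_piMl ?mulr_ge0 ?exprn_ge0 ?addr_ge0 //.
  by rewrite -[q]ger0_norm // ltW.
have lp : 0 < la ^+ n.+1 by rewrite exprn_gt0.
have lp' : 0 < la' ^+ n.+1 by rewrite exprn_gt0.
have half : la ^+ n.+1 / 2 < la ^+ n.+1 by lra.
have b1 : la' ^+ n.+1 * K <= la ^+ n.+1 / 2 by apply: le_trans bound; apply: ler_wpM2l; lra.
have b2 : la' ^+ n.+1 * K' <= la ^+ n.+1 / 2 by apply: le_trans bound; apply: ler_wpM2l; lra.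
have b3 : la' ^+ n.+1 <= la ^+ n.+1 / 2 by apply: le_trans bound; rewrite ler_peMr; lra.
exists n, (la ^+ n.+1 / 2); split; first by lra.
- by split; [exact: hK|exact: gap_diamond_not_le].
- by apply: hK' => //; exact: ltW.
- exact: gap_not_cp.
Qed.

End Separation.

(** * Joint eigenprojectors of the swaps *)

(** The two hypotheses say that the image of a projector of rank [d] and sign [s] keeps its pairings
    with the identity and the full swap; they determine the remainder on each parity class. The
    factor 2 avoids division. *)
Lemma solve_two_by_two (K : comNzRingType) (la d s uf ut Df Dt : K) :
  la * (1 * d) + 1 * (uf * 1 * Df + ut * 1 * Dt) = 1 * d ->
  la * (s * d) + 1 * (uf * 1 * Df + ut * (-1) * Dt) = s * d ->
  2 * (uf * Df) = (1 + s) * ((1 - la) * d) /\ 2 * (ut * Dt) = (1 - s) * ((1 - la) * d).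
Proof.
move=> e0 e1; split.
  transitivity ((la * (1 * d) + 1 * (uf * 1 * Df + ut * 1 * Dt)) +
    (la * (s * d) + 1 * (uf * 1 * Df + ut * (-1) * Dt)) - (1 + s) * la * d); first by ring.
  by rewrite e0 e1; ring.
transitivity ((la * (1 * d) + 1 * (uf * 1 * Df + ut * 1 * Dt)) -
    (la * (s * d) + 1 * (uf * 1 * Df + ut * (-1) * Dt)) - (1 - s) * la * d); first by ring.
by rewrite e0 e1; ring.
Qed.

Section SwapProjectors.
Variables (R : realType) (N : nat).
Hypothesis N5 : (5 <= N)%N.
Local Notation C := R[i].
Local Notation Q2 := (qb N * qb N)%type.
Local Notation F := (@swapop R N).
Local Notation S1 := (S_23N N).
Local Notation O := (~: S_23N N).
Local Notation full := [set: 'I_N]%SET.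

Lemma swapop_swp S T (x y : Q2) : F T (swp S x) y = F ((S :\: T) :|: (T :\: S)) x y.
Proof.
rewrite /swapop -swp_swp; congr ((nat_of_bool _)%:R).
by rewrite -(inj_eq (can_inj (swpK S))) swpK.
Qed.

(** The four swaps form a Klein four-group; this is the product of its group algebra. *)
Lemma opmul_swap4 (a0 a1 a2 a3 b0 b1 b2 b3 : C) :
  opmul (@swap4 R N a0 a1 a2 a3) (swap4 b0 b1 b2 b3) =
  swap4 (a0 * b0 + a1 * b1 + a2 * b2 + a3 * b3) (a0 * b1 + a1 * b0 + a2 * b3 + a3 * b2)
    (a0 * b2 + a2 * b0 + a1 * b3 + a3 * b1) (a0 * b3 + a3 * b0 + a1 * b2 + a2 * b1).
Proof.
apply/funext => x; apply/funext => y; set Y := swap4 b0 b1 b2 b3.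
transitivity (a0 * opmul (F finset.set0) Y x y + a1 * opmul (F O) Y x y +
  a2 * opmul (F S1) Y x y + a3 * opmul (F full) Y x y).
  by rewrite /opmul !mulr_sumr -!big_split; apply: eq_bigr => z _ /=; rewrite /swap4; ring.
rewrite !opmul_swap_l /Y /swap4 !swapop_swp.
rewrite !(finset.setD0, finset.set0D, finset.setDT, finset.setDv, finset.set0U, finset.setU0).
rewrite !finset.setTD !finset.setDE !(finset.setCK, finset.setIid, finset.setUid, finset.setUCr).
rewrite ?(finset.setUC O S1) ?finset.setUCr.
ring.
Qed.

Definition sgnb (b : bool) : R := (-1) ^+ b.

(** The character idempotents of the Klein group: (1 + s_1 F_1)(1 + s_2 F_(2..N)) / 4 expanded, with
    the signs given by [i]. *)
Definition swap_proj (i : bool * bool) : op R Q2 :=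
  swap4 (4^-1)%:C%C (sgnb i.1 / 4)%:C%C (sgnb i.2 / 4)%:C%C (sgnb i.1 * sgnb i.2 / 4)%:C%C.

Definition swap_dim (i : bool * bool) : R :=
  #|{: Q2}|%:R / 4 * (1 + sgnb i.1 / 2) * (1 + sgnb i.2 * (2^-1) ^+ (N - 1)).

Lemma swap_projM i j x y :
  opmul (swap_proj i) (swap_proj j) x y = (i == j)%:R * swap_proj i x y.
Proof.
rewrite /swap_proj opmul_swap4 -!rmorphM -!rmorphD /swap4.
have b4 : (i == j)%:R = ((i == j)%:R : R)%:C%C :> C by rewrite rmorph_nat.
rewrite b4; set e := (_%:R : R).
have -> : e%:C%C * (1 * ((4^-1)%:C%C * F finset.set0 x y + (sgnb i.1 / 4)%:C%C * F O x y) +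
    1 * ((sgnb i.2 / 4)%:C%C * F S1 x y + (sgnb i.1 * sgnb i.2 / 4)%:C%C * F full x y)) =
  1 * ((e * 4^-1)%:C%C * F finset.set0 x y + (e * (sgnb i.1 / 4))%:C%C * F O x y) +
    1 * ((e * (sgnb i.2 / 4))%:C%C * F S1 x y + (e * (sgnb i.1 * sgnb i.2 / 4))%:C%C * F full x y).
  by rewrite 4!(rmorphM (real_complex R) e); ring.
congr (1 * (_%:C%C * _ + _%:C%C * _) + 1 * (_%:C%C * _ + _%:C%C * _));
by rewrite /e; case: i {b4 e} => [[] []]; case: j => [[] []]; rewrite /sgnb /=; field.
Qed.

Lemma swap_projH i x y : conjc (swap_proj i x y) = swap_proj i y x.
Proof.
have fH T : conjc (F T x y) = F T y x by rewrite /swapop conjc_nat swp_eqC.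
rewrite /swap_proj /swap4 -!fH.
set c0 := (4^-1)%:C%C; set c1 := (_ / _)%:C%C; set c2 := (_ / _)%:C%C; set c3 := (_ / _)%:C%C.
by rewrite !mul1r !(conjcD, conjcM) !conjc_real.
Qed.

Lemma optr_swap (T : {set 'I_N}) : optr (F T) = (#|{: Q2}|%:R * (2^-1) ^+ #|T|)%:C%C.
Proof.
have := @sum_agree R N T (fun=> 1) (fun _ _ _ => erefl).
rewrite [\sum_(x : Q2) 1]sumr_const rmorphM rmorph_nat mulrC /= => <-.
apply: eq_bigr => x _; rewrite mulr1 /swapop; congr ((nat_of_bool _)%:R).
apply/eqP/res_eqP => [h i iT|h].
  by have := congr1 (fun z : Q2 => z.1 i) h; rewrite /= ffunE iT.
by apply: eq_qb2 => i; rewrite /= !ffunE; case: ifP => // iT; rewrite h.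
Qed.

Lemma swap_proj_tr i : optr (swap_proj i) = (swap_dim i)%:C%C.
Proof.
have cS1 : #|S1| = (N - 1)%N by rewrite cardsCs card_ord cardO.
have cF : #|full| = (N - 1).+1%N by rewrite cardsT card_ord subn1 prednK // (leq_trans _ N5).
rewrite /swap_proj; set c0 := (4^-1)%:C%C; set c1 := (_ / _)%:C%C; set c2 := (_ / _)%:C%C.
set c3 := (_ / _)%:C%C.
transitivity (c0 * optr (F finset.set0) + c1 * optr (F O) + c2 * optr (F S1) + c3 * optr (F full)).
  by rewrite /optr !mulr_sumr -!big_split; apply: eq_bigr => x _ /=; rewrite /swap4; ring.
rewrite !optr_swap cards0 (cardO N5) cS1 cF -!rmorphM -!rmorphD; congr (_%:C%C).
by rewrite /swap_dim (exprS _ (N - 1)); field.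
Qed.

Lemma swap_dim_gt0 i : 0 < swap_dim i.
Proof.
have h0 : 0 < (2^-1 : R) ^+ (N - 1) by rewrite exprn_gt0 ?invr_gt0.
have h1 : (2^-1 : R) ^+ (N - 1) < 1.
  by rewrite exprn_ilt1 ?invr_ge0 ?invf_lt1 ?ltr1n // subn_eq0 -ltnNge (leq_trans _ N5).
have M0 : 0 < #|{: Q2}|%:R :> R.
  by rewrite ltr0n; apply/card_gt0P; exists ([ffun=> false], [ffun=> false]).
rewrite /swap_dim mulr_gt0 ?mulr_gt0 ?divr_gt0 //; case: i => [[] []] /=;
  rewrite /sgnb /= ?expr0 ?expr1; lra.
Qed.

Lemma swap4_proj (c0 c1 c2 c3 : C) x y : @swap4 R N c0 c1 c2 c3 x y =
  \sum_i (c0 + (sgnb i.1)%:C%C * c1 + (sgnb i.2)%:C%C * c2 + (sgnb i.1 * sgnb i.2)%:C%C * c3)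
    * swap_proj i x y.
Proof.
rewrite sum_pair !big_bool /= /swap_proj /swap4 /sgnb /= expr0 expr1.
by rewrite !(rmorphM, rmorphN, rmorph1) /= fmorphV rmorph_nat; field.
Qed.

Local Notation dimc := (dim_class swap_dim).

(** On a projector the image is known up to a term in the span of the identity and the full swap,
    which symmetry and the two fixed points determine. A general [X] then needs no computation: its
    image has coefficients tested by projectors, and symmetry moves [Psi] onto them. *)
Lemma mixing_block la Psi : mixing_chan la Psi ->
  Psi = block_chan swap_proj (mixed_kernel swap_dim la).
Proof.
move=> [Ps [u0 uF] Pr Pe].
(* Functions of the parity alone give exactly the span of the identity and the full swap. *)
pose G (u : bool -> C) : op R Q2 := fun x y => \sum_j u (parity j) * swap_proj j x y.
have G0 : F finset.set0 = G (fun=> 1).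
  apply/funext => x; apply/funext => y; transitivity (@swap4 R N 1 0 0 0 x y).
    by rewrite /swap4; ring.
  by rewrite swap4_proj; apply: eq_bigr => i _; ring.
have GF : F full = G (fun b => (sgnb b)%:C%C).
  apply/funext => x; apply/funext => y; transitivity (@swap4 R N 0 0 0 1 x y).
    by rewrite /swap4; ring.
  rewrite swap4_proj; apply: eq_bigr => i _; congr (_ * _).
  have -> : sgnb i.1 * sgnb i.2 = sgnb (parity i).
    by rewrite /sgnb /parity; case: i => [[] []] /=; rewrite ?expr0 ?expr1; ring.
  ring.
have pG i u : pairing (swap_proj i) (G u) = u (parity i) * (swap_dim i)%:C%C.
  rewrite pairing_sumr (bigD1 i) //= big1 ?addr0.
    by rewrite pairingZr (pairing_proj swap_projM swap_proj_tr) eqxx mul1r.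
  move=> j ji; rewrite pairingZr (pairing_proj swap_projM swap_proj_tr).
  by rewrite eq_sym (negbTE ji) mul0r mulr0.
have GG u v : pairing (G u) (G v) = u false * v false * (dimc false)%:C%C
    + u true * v true * (dimc true)%:C%C.
  rewrite pairing_suml; under eq_bigr => i _ do rewrite pairingZl pG.
  rewrite /dim_class !rmorph_sum !mulr_sumr (bigID (fun i => parity i == false)) /=.
  congr (_ + _); first by apply: eq_bigr => i /eqP ->; rewrite mulrA.
  by apply: eq_big => i; [case: (parity i)|case: (parity i) => //; rewrite mulrA].
have Psip i : Psi (swap_proj i) = fun x y => la%:C%C * swap_proj i x y +
    1 * G (fun b => ((1 - la) * swap_dim i * (parity i == b)%:R / dimc b)%:C%C) x y.
  have [|a [b E]] := Pe (swap_proj i); first by do 4!eexists.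
  pose u c := a + b * (sgnb c)%:C%C.
  have E' : Psi (swap_proj i) = fun x y => la%:C%C * swap_proj i x y + 1 * G u x y.
    rewrite E G0 GF; apply/funext => x; apply/funext => y; congr (_ + 1 * _).
    rewrite /G !mulr_sumr -big_split; apply: eq_bigr => j _ /=; rewrite /u; ring.
  have e0 : pairing (Psi (swap_proj i)) (G (fun=> 1)) = pairing (swap_proj i) (G (fun=> 1)).
    by rewrite Ps -G0 u0.
  have eF : pairing (Psi (swap_proj i)) (G (fun b => (sgnb b)%:C%C)) =
      pairing (swap_proj i) (G (fun b => (sgnb b)%:C%C)).
    by rewrite Ps -GF uF.
  rewrite E' [RHS]pG pairingDl 2!pairingZl pG GG in e0.
  rewrite E' [RHS]pG pairingDl 2!pairingZl pG GG in eF.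
  have Dn c : (dimc c)%:C%C != 0.
    by rewrite fmorph_eq0 gt_eqF //; apply: dim_class_gt0; exact: swap_dim_gt0.
  have C2 : 2 != 0 :> C by rewrite pnatr_eq0.
  have uE c : u c = ((1 - la) * swap_dim i * (parity i == c)%:R / dimc c)%:C%C.
    apply: (mulIf (Dn c)); apply: (mulfI C2).
    have -> : ((1 - la) * swap_dim i * (parity i == c)%:R / dimc c)%:C%C * (dimc c)%:C%C =
        (1 - la%:C%C) * (swap_dim i)%:C%C * (parity i == c)%:R.
      rewrite -rmorphM divfK; first by rewrite 2!rmorphM rmorphB rmorph1 rmorph_nat.
      by rewrite gt_eqF //; apply: dim_class_gt0; exact: swap_dim_gt0.
    rewrite (_ : sgnb false = 1) // (_ : sgnb true = -1) // rmorphN1 rmorph1 in eF.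
    have [h1 h2] := solve_two_by_two e0 eF.
    have sE : (sgnb (parity i))%:C%C = 1 - 2 * (parity i)%:R :> C.
      by case: (parity i); rewrite /sgnb ?rmorphN1 ?rmorph1 /=; ring.
    case: c; [rewrite h2|rewrite h1]; rewrite sE; case: (parity i);
      rewrite /=; ring.
  rewrite E'; apply/funext => x; apply/funext => y; congr (_ + 1 * _).
  by apply: eq_bigr => j _; rewrite uE.
apply/funext => X; apply/funext => x; apply/funext => y.
have [c0 [c1 [c2 [c3 E]]]] := Pr X; rewrite E swap4_proj; apply: eq_bigr => i _.
set c := _ + _ * c3; rewrite -mulr_suml; congr (_ * _).
have dn : (swap_dim i)%:C%C != 0 by rewrite fmorph_eq0 gt_eqF // swap_dim_gt0.
have Dn b : dimc b != 0 by rewrite gt_eqF //; apply: dim_class_gt0; exact: swap_dim_gt0.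
apply: (mulIf dn).
(* The coefficient times the rank is the pairing of [Psi X] with the projector, and by symmetry that
   of [X] with the image of the projector. *)
have -> : c * (swap_dim i)%:C%C = pairing (Psi (swap_proj i)) X.
  rewrite Ps E.
  have -> : @swap4 R N c0 c1 c2 c3 = fun x y => \sum_j (c0 + (sgnb j.1)%:C%C * c1 +
      (sgnb j.2)%:C%C * c2 + (sgnb j.1 * sgnb j.2)%:C%C * c3) * swap_proj j x y.
    by apply/funext => x'; apply/funext => y'; exact: swap4_proj.
  rewrite pairing_sumr (bigD1 i) //= big1 ?addr0.
    by rewrite pairingZr (pairing_proj swap_projM swap_proj_tr) eqxx mul1r.
  move=> j ji; rewrite pairingZr (pairing_proj swap_projM swap_proj_tr).
  by rewrite eq_sym (negbTE ji) mul0r mulr0.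
rewrite Psip pairingDl !pairingZl pairing_suml mul1r mulr_suml.
transitivity (\sum_j ((i == j)%:R * (la%:C%C * pairing (swap_proj j) X) +
  ((1 - la) * swap_dim i * (parity i == parity j)%:R / dimc (parity j))%:C%C * pairing (swap_proj j) X)).
  rewrite big_split /= sum_delta; congr (_ + _).
  by apply: eq_bigr => j _; rewrite pairingZl.
apply: eq_bigr => j _.
have -> : (i == j)%:R = ((i == j)%:R)%:C%C :> C by rewrite rmorph_nat.
rewrite mulrA -rmorphM -mulrDl -rmorphD [RHS]mulrAC -rmorphM; congr (_%:C%C * _).
rewrite /mixed_kernel /local_kernel /haar_kernel.
have dn' : swap_dim i != 0 by rewrite gt_eqF // swap_dim_gt0.
by have [<-|_] := eqVneq (parity i) (parity j); rewrite /=; field; rewrite ?dn' ?Dn.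
Qed.

End SwapProjectors.

Theorem theorem1 (R : realType) :
  exists N0 : nat, forall N : nat, (3 <= N)%N -> (N0 <= N)%N ->
  forall mu1 mu2 mu3 muH : probability (MT R N) R,
    is_haar (S_23N N) mu1 -> is_haar (S_12 N) mu2 -> is_haar (S_134N N) mu3 ->
    is_haar [set: 'I_N] muH ->
    (exists eps : R, 0 < eps /\ exists d : nat, (0 < d)%N /\
        additive_design (iter d (moment_C' mu1 mu3)) (moment2 muH) eps /\
        ~ additive_design (iter d (moment_C mu1 mu2 mu3)) (moment2 muH) eps) /\
    (exists eps : R, 0 < eps /\ exists d : nat, (0 < d)%N /\
        multiplicative_design (iter d (moment_C' mu1 mu3)) (moment2 muH) eps /\
        ~ multiplicative_design (iter d (moment_C mu1 mu2 mu3)) (moment2 muH) eps).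
Proof.
exists 5%N => N _ N5 mu1 mu2 mu3 muH h1 h2 h3 hH.
have T1 := haar_twirl h1; have T2 := haar_twirl h2; have T3 := haar_twirl h3.
have TH := haar_twirl hH.
have [la0 lal] := eigenvalue_lt R N5.
set la' := _ ^+ 2 in la0 lal; set la := (_ * _) ^+ 2 in lal.
have E' n : iter n.+1 (moment_C' mu1 mu3) =
    block_chan (@swap_proj R N) (mixed_kernel (swap_dim R N) (la' ^+ n.+1)).
  apply: (mixing_block N5); apply: mixing_chan_iter.
  exact: (mixing_C' N5 T1 T3).
have E n : iter n.+1 (moment_C mu1 mu2 mu3) =
    block_chan (@swap_proj R N) (mixed_kernel (swap_dim R N) (la ^+ n.+1)).
  apply: (mixing_block N5); apply: mixing_chan_iter.
  exact: (mixing_C N5 T1 T2 T3).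
have EH : moment2 muH = block_chan (@swap_proj R N) (mixed_kernel (swap_dim R N) 0).
  by apply: (mixing_block N5); exact: haar_mixing N5 _ TH.
pose x0 : qb N * qb N := ([ffun=> false], [ffun=> false]).
have [n [eps [eps0 [D1 D2] M1 M2]]] := kernel_separation (@swap_projM R N) (@swap_projH R N)
  (swap_proj_tr R N5) (swap_dim_gt0 R N5) x0 la0 lal.
split; exists eps; (split; first exact: eps0); exists n.+1; split => //; split.
- by rewrite /additive_design (E' n) EH block_chan_gap; exact: D1.
- by rewrite /additive_design (E n) EH block_chan_gap; exact: D2.
- have [e1 e2] := multiplicative_blockE (@swap_proj R N) (swap_dim R N) (la' ^+ n.+1) eps.
  by rewrite /multiplicative_design (E' n) EH e1 e2; exact: M1.
- have [e1 e2] := multiplicative_blockE (@swap_proj R N) (swap_dim R N) (la ^+ n.+1) eps.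
  (* It is the first of the two complete positivity conditions that fails. *)
  by rewrite /multiplicative_design (E n) EH e1 e2 => -[/M2].
Qed.
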